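(* Consider, for each dimension $p$, the INO-PCA iterates driven by the spiked covariance data described in the context, with fixed parameters $\omega>0$, $\tau>0$. Assume that the law of $\mathbf{x}_0$ is exchangeable, that $\sup_p\langle x^4+\xi^4,\mu_0^p\rangle\le C$ for some finite constant $C$, that $\mu_0^p$ converges weakly to a deterministic $\mu_0\in\mathcal{M}(\mathbb{R}^2)$ as $p\to\infty$, that $\lambda_0=\Theta(1)$, and that the initial cosine similarity satisfies $Q_0\ne 0$. Let $(\mu_t)_{t\ge0}$ be the deterministic limit of $\mu^p_{\lfloor pt\rfloor}$ as $p\to\infty$, i.e. the unique solution of the weak-form PDE given in the context, and let $\lambda_t=\sqrt{\langle x^2,\mu_t\rangle}$ and $Q_t=\langle x\xi,\mu_t\rangle/\lambda_t$. Then the norm parameter $\lambda_t$ satisfies the ODE $$\frac{d}{dt}\lambda_t=\tau\Big(\omega Q_t^2+1-\lambda_t+\frac{\tau(\omega Q_t^2+1)}{2\lambda_t}\Big).$$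
   Context: Data (spiked covariance model): for each $p$, $\boldsymbol{\xi}=\boldsymbol{\xi}^{(p)}\in\mathbb{R}^p$ is a fixed vector with $\|\boldsymbol{\xi}\|=\sqrt p$. The samples are $\mathbf{y}_k=\sqrt{\omega/p}\,c_k\boldsymbol{\xi}+\mathbf{a}_k$, $k\ge0$, where $c_k\sim\mathcal{N}(0,1)$ and $\mathbf{a}_k\sim\mathcal{N}(0,\mathbf{I}_p)$ are independent of each other, independent over $k$, and independent of $\mathbf{x}_0$. Algorithm (INO-PCA): $\mathbf{x}_{k+1}=\mathbf{x}_k+\frac{\tau}{p}\big(\mathbf{y}_k\mathbf{y}_k^\top\frac{\mathbf{x}_k}{\lambda_k}-\mathbf{x}_k\big)$ with $\lambda_k=\|\mathbf{x}_k\|/\sqrt p$. The cosine similarity at step $k$ is $Q_k=\boldsymbol{\xi}^\top\mathbf{x}_k/(p\lambda_k)$. Empirical measures: $\mu_k^p=\frac1p\sum_{i=1}^p\delta_{(x_k^i,\xi^i)}\in\mathcal{M}(\mathbb{R}^2)$ (probability measures on $\mathbb{R}^2$), with $\langle f,\mu\rangle$ denoting the integral of $f(x,\xi)$ against $\mu$. The process $t\mapsto\mu^p_{\lfloor pt\rfloor}$ is a random element of the Skorokhod space $\mathcal{D}(\mathbb{R}^+,\mathcal{M}(\mathbb{R}^2))$, and convergence is weak convergence there. A random vector is exchangeable if its law is invariant under coordinate permutations; $\lambda_0=\Theta(1)$ means bounded above and away from $0$ uniformly in $p$. Weak-form PDE: for every positive, bounded, $C^3$ function $f:\mathbb{R}^2\to\mathbb{R}$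 and all $t\ge0$, $$\langle f,\mu_t\rangle-\langle f,\mu_0\rangle=\int_0^t\Big\langle G(x,\lambda_{\hat t},\xi,Q_{\hat t})\frac{\partial f}{\partial x},\mu_{\hat t}\Big\rangle d\hat t+\frac12\int_0^t\Big\langle J(Q_{\hat t})\frac{\partial^2 f}{\partial x^2},\mu_{\hat t}\Big\rangle d\hat t,$$ with $G(x,\lambda,\xi,Q)=\tau(\omega Q\xi+x/\lambda-x)$, $J(Q)=\tau^2(\omega Q^2+1)$, $\lambda_t=\sqrt{\langle x^2,\mu_t\rangle}$ and $Q_t=\langle x\xi,\mu_t\rangle/\lambda_t$. (Under the stated assumptions, the weak convergence of $\mu^p_{\lfloor pt\rfloor}$ to the unique solution of this PDE is an established result of the same paper.) *)

(* Defs.v *)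
From HB Require Import structures.
From mathcomp Require Import all_boot all_order all_algebra all_fingroup archimedean.
From mathcomp Require Import all_classical all_reals all_analysis.

Set Implicit Arguments.
Unset Strict Implicit.
Unset Printing Implicit Defensive.

Import Order.TTheory GRing.Theory Num.Theory.
Import numFieldNormedType.Exports.

Local Open Scope classical_set_scope.
Local Open Scope ring_scope.

(* An increasing bijection of [0, +oo[ onto itself is automatically
   continuous. *)
Definition time_change (R : realType) (h : R -> R) :=
  set_bij [set t | 0 <= t] [set t | 0 <= t] h /\
  (forall s t, 0 <= s -> s < t -> h s < h t).

(* Cadlag functions on [0, +oo[ are represented by functions on R that are
   extended to negative times by their value at 0, so that elements of
   [skorokhod R S] correspond one to one to cadlag functions on [0, +oo[. *)
Record skorokhod (R : realType) (S : uniformType) := Skorokhod {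
  path :> R -> S ;
  path_right : forall t, 0 <= t -> path s @[s --> t^'+] --> path t ;
  path_left : forall t, 0 < t -> exists l : S, path s @[s --> t^'-] --> l ;
  path_neg : forall t, t < 0 -> path t = path 0 }.

(* The Skorokhod J1 topology: x_n --> x iff, for every T, there are time
   changes h_n such that, uniformly for t in [0, T], h_n t - t tends to 0 and
   x_n t gets close to x (h_n t).  For metrizable S it does not depend on the
   choice of a uniformity compatible with the topology of S, since the range
   of a cadlag function on [0, T] is relatively compact. *)
Section skorokhod_topology.
Variables (R : realType) (S : uniformType).

Definition skorokhod_ball (x : skorokhod R S) (T e : R) (E : set (S * S)) :
    set (skorokhod R S) :=
  [set y | exists2 h : R -> R, time_change h &
     forall t, 0 <= t <= T -> `|h t - t| < e /\ E (x (h t), y t)].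

Definition skorokhod_nbhs (x : skorokhod R S) : set_system (skorokhod R S) :=
  [set A | exists T e E, [/\ 0 < T, 0 < e, entourage E &
     skorokhod_ball x T e E `<=` A]].

HB.instance Definition _ := gen_eqMixin (skorokhod R S).
HB.instance Definition _ := gen_choiceMixin (skorokhod R S).
HB.instance Definition _ := hasNbhs.Build (skorokhod R S) skorokhod_nbhs.

Lemma time_change_id : time_change (@id R).
Proof. by split=> //; split=> // t t0; exists t. Qed.

Lemma time_change_ge0 (h : R -> R) t : time_change h -> 0 <= t -> 0 <= h t.
Proof. by case=> -[hf _ _] _ t0; apply: (hf t). Qed.

Lemma time_change_comp (g h : R -> R) :
  time_change g -> time_change h -> time_change (g \o h).
Proof.
move=> tg th; have [bg ig] := tg; have [bh ih] := th; split.
  exact: set_bij_comp bh bg.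
move=> s t s0 st /=; apply: ig; first exact: time_change_ge0.
exact: ih.
Qed.

Let ball_center x T e E : 0 < e -> entourage E -> skorokhod_ball x T e E x.
Proof.
move=> e0 entE; exists id; first exact: time_change_id.
by move=> t _; rewrite subrr normr0; split=> //; exact: entourage_refl.
Qed.

Let skorokhod_nbhs_filter (x : skorokhod R S) : ProperFilter (nbhs x).
Proof.
split.
  move=> [T [e [E [_ e0 entE sub]]]].
  exact: sub (ball_center x T e0 entE).
split.
- exists 1, 1, setT; split=> //; exact: entourageT.
- move=> A B [T [e [E [T0 e0 entE subA]]]] [T' [e' [E' [T'0 e'0 entE' subB]]]].
  exists (Num.max T T'), (Num.min e e'), (E `&` E'); split.
  + by rewrite lt_max T0.
  + by rewrite lt_min e0.
  + exact: filterI.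
  move=> y [h th hy]; split.
    apply: subA; exists h => // t /andP[t0 tT].
    have [|] := hy t; first by rewrite t0 le_max tT.
    by rewrite lt_min => /andP[? _] [? _].
  apply: subB; exists h => // t /andP[t0 tT].
  have [|] := hy t; first by rewrite t0 le_max tT orbT.
  by rewrite lt_min => /andP[_ ?] [_ ?].
- move=> A B AB [T [e [E [T0 e0 entE sub]]]].
  by exists T, e, E; split=> //; exact: subset_trans AB.
Qed.

Let skorokhod_nbhs_singleton (x : skorokhod R S) A : nbhs x A -> A x.
Proof.
by move=> [T [e [E [_ e0 entE sub]]]]; exact: sub (ball_center x T e0 entE).
Qed.

Let skorokhod_nbhs_nbhs (x : skorokhod R S) A : nbhs x A -> nbhs x (nbhs^~ A).
Proof.
move=> [T [e [E [T0 e0 entE sub]]]].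
have [E' entE' splitE] := entourage_split_ex entE.
pose e' := Num.min (e / 2) 1.
have e'0 : 0 < e' by rewrite lt_min divr_gt0 //=.
have T'0 : 0 < T + 1 by rewrite addr_gt0.
exists (T + 1), e', E'; split=> // y [h th hy].
exists (T + 1), e', E'; split=> // z [g tg gz].
apply: sub; exists (h \o g); first exact: time_change_comp.
move=> t /andP[t0 tT].
have [g1 Eyz] : `|g t - t| < e' /\ E' (y (g t), z t).
  by apply: gz; rewrite t0 (le_trans tT)// lerDl.
have gt_range : 0 <= g t <= T + 1.
  rewrite time_change_ge0 //=.
  have : g t - t < 1.
    by apply: le_lt_trans (ler_norm _) _; rewrite (lt_le_trans g1)// ge_min lexx orbT.
  by rewrite ltrBlDr => /ltW/le_trans; apply; rewrite addrC lerD2r.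
have [h1 Exy] := hy _ gt_range.
split => /=; last by apply: splitE; exists (y (g t)).
have -> : h (g t) - t = (h (g t) - g t) + (g t - t) by rewrite addrA subrK.
rewrite (le_lt_trans (ler_normD _ _))// [e]splitr ltrD//.
  by rewrite (lt_le_trans h1)// ge_min lexx.
by rewrite (lt_le_trans g1)// ge_min lexx.
Qed.

HB.instance Definition _ := Nbhs_isNbhsTopological.Build (skorokhod R S)
  skorokhod_nbhs_filter skorokhod_nbhs_singleton skorokhod_nbhs_nbhs.

End skorokhod_topology.

Section step_path.
Variables (R : realType) (S : uniformType) (a : R) (v : nat -> S).
Hypothesis a0 : 0 < a.

Let step (t : R) := v (Num.truncn (a * t)).

Let step_right t : 0 <= t -> step s @[s --> t^'+] --> step t.
Proof.
move=> t0; have at0 : 0 <= a * t by rewrite mulr_ge0// ltW.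
have /andP[lo up] := truncn_itv at0.
apply: cvg_near_cst; near=> s; rewrite /step; congr v.
have ts : t < s by near: s; exact: nbhs_right_gt.
apply: truncn_def.
rewrite (le_trans lo) ?ler_pM2l ?(ltW ts) //=.
rewrite mulrC -ltr_pdivlMr//; near: s; apply: nbhs_right_lt.
by rewrite ltr_pdivlMr// mulrC.
Unshelve. all: by end_near. Qed.

Let step_left t : 0 < t -> exists l : S, step s @[s --> t^'-] --> l.
Proof.
move=> t0; have at0 : 0 < a * t by rewrite mulr_gt0.
have [m /andP[lo up]] : exists m : nat, m%:R < a * t <= m.+1%:R.
  have /andP[lo up] := truncn_itv (ltW at0).
  have [e|ne] := eqVneq (Num.truncn (a * t))%:R (a * t).
    case: (Num.truncn _) e => [e|m e]; first by move: at0; rewrite -e ltxx.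
    by exists m; rewrite -e ltr_nat leqnn /= lexx.
  by exists (Num.truncn (a * t)); rewrite lt_neqAle ne lo ltW.
exists (v m); apply: cvg_near_cst; near=> s; rewrite /step; congr v.
have st : s < t by near: s; exact: nbhs_left_lt.
apply: truncn_def; apply/andP; split; last first.
  by rewrite (lt_le_trans _ up)// ltr_pM2l.
rewrite mulrC -ler_pdivrMr//; near: s; apply: nbhs_left_ge.
by rewrite ltr_pdivrMr// mulrC.
Unshelve. all: by end_near. Qed.

Let step_neg t : t < 0 -> step t = step 0.
Proof.
move=> t0; rewrite /step mulr0 truncn0; congr v; apply/eqP.
by rewrite -leqn0 truncn_le_nat// (lt_trans _ ltr01)// pmulr_rlt0.
Qed.

(* t |-> v_{floor (a t)} *)
Definition step_path : skorokhod R S := Skorokhod step_right step_left step_neg.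

End step_path.

(* The space M(R^2) of probability measures on R^2, with the topology (and
   the uniformity) of weak convergence: the coarsest one that makes
   m |-> \int f dm uniformly continuous for every bounded continuous f. *)
Section weak_topology.
Variable R : realType.

Record bounded_continuous := BoundedContinuous {
  bc_fun :> R * R -> R ;
  bc_continuous : continuous bc_fun ;
  bc_bounded : exists M, forall z, `|bc_fun z| <= M }.

Definition bracket (f : R * R -> R) (m : probability (R * R)%type R) : R :=
  \int[m]_z f z.

Definition integrals (m : probability (R * R)%type R) :
    prod_topology (fun _ : bounded_continuous => R) :=
  fun f => bracket f m.

Definition measR2 := initial_topology integrals.
HB.instance Definition _ := Uniform.on measR2.

End weak_topology.

(* Weak convergence, as p --> oo, of random elements X_p of a topological
   space, possibly defined on different probability spaces, to a
   deterministic limit l. *)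
Definition weak_cvg_to_point (R : realType) (d : nat -> measure_display)
    (Om : forall p, measurableType (d p)) (P : forall p, probability (Om p) R)
    (S : topologicalType) (X : forall p, Om p -> S) (l : S) :=
  forall F : S -> R, continuous F -> (exists M, forall s, `|F s| <= M) ->
    \int[P p]_w F (X p w) @[p --> \oo] --> F l.

Section independence.
Variables (d : measure_display) (Om : measurableType d) (R : realType).
Variable P : probability Om R.

(* the sigma-algebra generated by X, for the Borel sigma-algebra of U *)
Definition sigma_of (U : topologicalType) (X : Om -> U) : set_system Om :=
  preimage_set_system setT X <<s open >>.

Definition random_element (U : topologicalType) (X : Om -> U) :=
  sigma_of X `<=` measurable.

Definition mutually_independent (I : eqType) (F : I -> set_system Om) :=
  forall (s : seq I) (A : I -> set Om), uniq s ->
    (forall i, i \in s -> F i (A i)) ->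
    P (\big[setI/setT]_(i <- s) A i) = (\prod_(i <- s) P (A i))%E.

Definition std_normal (X : Om -> R) :=
  random_element X /\
  forall B : set R, measurable B -> P (X @^-1` B) = normal_prob 0 1 B.

Definition std_normal_vector n (X : Om -> 'cV[R]_n) :=
  [/\ random_element X,
      forall i, std_normal (fun w => X w i 0) &
      mutually_independent (fun i => sigma_of (fun w => X w i 0))].

Definition exchangeable n (X : Om -> 'cV[R]_n) :=
  forall (s : 'S_n) (B : set 'cV[R]_n), <<s open >> B ->
    P ((fun w => row_perm s (X w)) @^-1` B) = P (X @^-1` B).

(* x0 is indexed by None, c_k by inl k and a_k by inr k. *)
Definition sources n (x0 : Om -> 'cV[R]_n) (c : nat -> Om -> R)
    (a : nat -> Om -> 'cV[R]_n) (i : option (nat + nat)) : set_system Om :=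
  match i with
  | None => sigma_of x0
  | Some (inl k) => sigma_of (c k)
  | Some (inr k) => sigma_of (a k)
  end.

Definition spiked_noise n (x0 : Om -> 'cV[R]_n) (c : nat -> Om -> R)
    (a : nat -> Om -> 'cV[R]_n) :=
  [/\ random_element x0,
      forall k, std_normal (c k),
      forall k, std_normal_vector (a k) &
      mutually_independent (sources x0 c a)].

End independence.

Section algorithm.
Variables (R : realType) (n : nat).
Implicit Types x y xi a : 'cV[R]_n.

(* The library norm on matrices is the sup norm. *)
Definition norm2 x : R := Num.sqrt (\sum_i x i 0 ^+ 2).

Definition vec_lambda x : R := norm2 x / Num.sqrt n%:R.

Definition vec_cosine xi x : R := (\sum_i xi i 0 * x i 0) / (n%:R * vec_lambda x).

Definition sample (om : R) xi (c : R) a : 'cV[R]_n :=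
  (Num.sqrt (om / n%:R) * c) *: xi + a.

Definition ino_step (tau : R) y x : 'cV[R]_n :=
  x + (tau / n%:R) *: (y *m y^T *m ((vec_lambda x)^-1 *: x) - x).

Fixpoint ino_iterate (tau : R) (y : nat -> 'cV[R]_n) x0 (k : nat) : 'cV[R]_n :=
  if k is k'.+1 then ino_step tau (y k') (ino_iterate tau y x0 k') else x0.

End algorithm.

Section empirical.
Variables (R : realType) (n : nat) (x xi : 'cV[R]_n.+1).
Local Open Scope ereal_scope.

Definition empirical (A : set (R * R)) : \bar R :=
  (n.+1%:R^-1)%:E * \sum_(i < n.+1) \d_((x i ord0, xi i ord0)) A.

Let empirical0 : empirical set0 = 0.
Proof.
by rewrite /empirical big1 ?mule0// => i _; rewrite measure0.
Qed.

Let empirical_ge0 A : 0 <= empirical A.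
Proof.
by rewrite mule_ge0 ?sume_ge0// => [|i _]; rewrite ?lee_fin ?invr_ge0 ?ler0n.
Qed.

Let empirical_sigma_additive : semi_sigma_additive empirical.
Proof.
move=> F mF tF mUF; rewrite /empirical.
rewrite (_ : (fun _ => _) = (fun k => (n.+1%:R^-1)%:E *
    \sum_(i < n.+1) \sum_(0 <= j < k) \d_((x i ord0, xi i ord0)) (F j))).
  apply: cvgeZl => //; apply: cvg_nnesum => [i _|i _].
    by apply: nearW => k; exact: sume_ge0.
  exact: measure_semi_sigma_additive.
apply/funext => k; rewrite exchange_big /= ge0_sume_distrr// => j _.
exact: sume_ge0.
Qed.

HB.instance Definition _ := isMeasure.Build _ _ _ empirical
  empirical0 empirical_ge0 empirical_sigma_additive.

Let empiricalT : empirical setT = 1.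
Proof.
rewrite /empirical (eq_bigr (fun=> 1%:E)); last by move=> i _; rewrite diracT.
by rewrite sumEFin sumr_const card_ord -EFinM mulVf// pnatr_eq0.
Qed.

HB.instance Definition _ := Measure_isProbability.Build _ _ _ empirical
  empiricalT.

Definition emp : measR2 R := (empirical : probability (R * R)%type R).

End empirical.

(* t |-> mu^p_{floor (p t)} for p = n.+1 *)
Definition emp_process (R : realType) n (x : nat -> 'cV[R]_n.+1)
    (xi : 'cV[R]_n.+1) : skorokhod R (measR2 R) :=
  step_path (fun k => emp (x k) xi) (ltr0Sn R n).

Section weak_pde.
Variable R : realType.
Implicit Types (f : R * R -> R) (m : measR2 R).

Definition d_x f : R * R -> R := 'D_(1, 0) f.
Definition d_xi f : R * R -> R := 'D_(0, 1) f.

(* Partial derivatives of order at most k exist and are continuous. *)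
Fixpoint class_C (k : nat) f : Prop :=
  continuous f /\
  if k is k'.+1 then
    [/\ forall z, derivable f z (1, 0), forall z, derivable f z (0, 1),
        class_C k' (d_x f) & class_C k' (d_xi f)]
  else True.

Definition lambda_of m : R := Num.sqrt (bracket (fun z => z.1 ^+ 2) m).

Definition cosine_of m : R := bracket (fun z => z.1 * z.2) m / lambda_of m.

Definition drift (tau om x lam xi Q : R) : R :=
  tau * (om * Q * xi + x / lam - x).

Definition diffusion (tau om Q : R) : R := tau ^+ 2 * (om * Q ^+ 2 + 1).

Definition drift_term tau om f m (z : R * R) : R :=
  drift tau om z.1 (lambda_of m) z.2 (cosine_of m) * d_x f z.

Definition diffusion_term tau om f m (z : R * R) : R :=
  diffusion tau om (cosine_of m) * d_x (d_x f) z.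

Definition abs_convergent (g : measR2 R -> R * R -> R) (mu : R -> measR2 R)
    (t : R) :=
  (\int[lebesgue_measure]_(s in `[0%R, t])
     \int[mu s : probability (R * R)%type R]_z `|g (mu s) z|%:E < +oo)%E.

(* As the derivatives of a bounded C^3 function need not be bounded, the
   identity is only required where its right-hand side is absolutely
   convergent. *)
Definition weak_solution (tau om : R) (mu : R -> measR2 R) :=
  forall f, (forall z, 0 < f z) -> (exists M, forall z, `|f z| <= M) ->
    class_C 3 f -> forall t, 0 <= t ->
    abs_convergent (drift_term tau om f) mu t ->
    abs_convergent (diffusion_term tau om f) mu t ->
    bracket f (mu t) - bracket f (mu 0) =
      (\int[lebesgue_measure]_(s in `[0, t])
         bracket (drift_term tau om f (mu s)) (mu s)) +
      2^-1 * (\int[lebesgue_measure]_(s in `[0, t])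
         bracket (diffusion_term tau om f (mu s)) (mu s)).

End weak_pde.

(* Main.v *)
(** Test the equation against 1 + l^2 / (1 + e l^2), where l = b x + a xi, and
    let e tend to 0: this gives integral equations for <x^2>, <xi^2> and
    <(x + xi)^2>.  The passage to the limit needs a bound on <x^2>, which must
    not presuppose one on 1 / lambda.  By the inequality
    |x p| / lambda <= (x / lambda)^2 + p^2 / 4, the singular term only involves
    <(x / lambda)^2> <= 1, and similarly |Q| <= (1 + <xi^2>) / 2, so the
    truncated second moment obeys a linear Gronwall inequality that is uniform
    in e.  By polarization <x xi> is then continuous in time; the noise keeps
    lambda positive, so Q is continuous as well, and the integral equation for
    lambda^2 can be differentiated at every time. *)

Require Import Defs.
From HB Require Import structures.
From mathcomp Require Import all_boot all_order all_algebra all_fingroup archimedean.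
From mathcomp Require Import all_classical all_reals all_analysis.
From mathcomp Require Import measurable_realfun ring lra.

Set Implicit Arguments.
Unset Strict Implicit.
Unset Printing Implicit Defensive.

Import Order.TTheory GRing.Theory Num.Theory.
Import numFieldNormedType.Exports.

Local Open Scope classical_set_scope.
Local Open Scope ring_scope.

(** * Truncated squares *)

Section truncated_square.
Variable R : realType.
Implicit Types (e y c : R) (phi : R -> R) (p : {poly R}).

(** Two circularities shape the argument. Continuity and positivity of lambda come out of the
    integral equation for lambda^2, but deriving that equation already requires control of a drift
    containing 1 / lambda. Until then every estimate has to tolerate lambda = 0, where division by
    zero gives 0 and both x / lambda and Q vanish. Moreover, the weak equation may be used for a
    test function only once its right-hand side is known to converge absolutely, so each use is
    preceded by a bound uniform in time.

    The rational truncation f is chosen because its derivatives are controlled by f itself,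
    uniformly in e: |y f'| <= 2 f, f'^2 / 4 <= f and |f''| <= 6. This is what closes the Gronwall
    inequality on a truncated moment.

    Paths are only right continuous, and only when tested against bounded functions. Measurability
    in time of lambda and Q is therefore a separate matter, settled after the moment bound and
    before dominated convergence in time.

    At time 0 weak convergence alone could lose second moment at infinity; the fourth moments bound
    this loss and so keep lambda_0 positive. *)

Definition tsq e y : R := y ^+ 2 / (1 + e * y ^+ 2).
Definition dtsq e y : R := 2 * y / (1 + e * y ^+ 2) ^+ 2.
Definition ddtsq e y : R := (2 - 6 * e * y ^+ 2) / (1 + e * y ^+ 2) ^+ 3.

Lemma tsq_den_gt0 e y : 0 <= e -> 0 < 1 + e * y ^+ 2.
Proof. by move=> e0; rewrite ltr_pwDl// mulr_ge0// sqr_ge0. Qed.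

Lemma tsq_ge0 e y : 0 <= e -> 0 <= tsq e y.
Proof. by move=> e0; rewrite divr_ge0 ?sqr_ge0// ltW// tsq_den_gt0. Qed.

Lemma tsq_le_sqr e y : 0 <= e -> tsq e y <= y ^+ 2.
Proof.
move=> e0; rewrite ler_pdivrMr ?tsq_den_gt0// ler_peMr ?sqr_ge0//.
by rewrite lerDl mulr_ge0// sqr_ge0.
Qed.

Lemma tsq_le_inv e y : 0 < e -> tsq e y <= e^-1.
Proof.
move=> e0; rewrite ler_pdivrMr ?tsq_den_gt0 ?(ltW e0)// mulrDr mulr1.
by rewrite mulKf ?gt_eqF// lerDr invr_ge0 ltW.
Qed.

(** These are the first two terms of the geometric expansion in e. The error e y^4 is what a fourth
    moment controls. *)
Lemma tsq_ge e y : 0 <= e -> y ^+ 2 - e * y ^+ 4 <= tsq e y.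
Proof.
move=> e0; rewrite ler_pdivlMr ?tsq_den_gt0//.
have : 0 <= e ^+ 2 * y ^+ 6 by rewrite mulr_ge0 ?sqr_ge0// (exprM y 3 2) sqr_ge0.
by nra.
Qed.

(** At e = 0 this is an equality, which explains the factor 4. It bounds the square of the test
    derivative by the truncated moment itself, as Gronwall requires. *)
Lemma dtsq_sqr_le e y : 0 <= e -> dtsq e y ^+ 2 / 4 <= tsq e y.
Proof.
move=> e0; have d0 := tsq_den_gt0 y e0.
rewrite /dtsq /tsq expr_div_n -exprM mulnE /=.
rewrite ler_pdivrMr// ler_pdivrMr ?exprn_gt0//.
have -> : y ^+ 2 / (1 + e * y ^+ 2) * 4 * (1 + e * y ^+ 2) ^+ 4 =
    4 * y ^+ 2 * (1 + e * y ^+ 2) ^+ 3.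
  by field; rewrite gt_eqF.
have -> : (2 * y) ^+ 2 = 4 * y ^+ 2 by ring.
have y2 : 0 <= 4 * y ^+ 2 by rewrite mulr_ge0// sqr_ge0.
rewrite ler_peMr// exprn_ege1// lerDl.
by rewrite mulr_ge0// sqr_ge0.
Qed.

Lemma dtsq_le e y : 0 <= e -> `|dtsq e y| <= 2 * `|y|.
Proof.
move=> e0; have d0 := tsq_den_gt0 y e0.
rewrite /dtsq normrM normrM (ger0_norm (ler0n _ _)) normfV.
rewrite ler_pdivrMr ?normr_gt0 ?gt_eqF ?exprn_gt0//.
rewrite ler_peMr ?mulr_ge0// ger0_norm ?exprn_ge0 ?(ltW d0)//.
by rewrite exprn_ege1// lerDl mulr_ge0// sqr_ge0.
Qed.

(** Differentiation only adds a denominator that is at least 1. This controls the linear part - x of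
    the drift by the truncated moment. *)
Lemma mul_dtsq_le e y : 0 <= e -> `|y * dtsq e y| <= 2 * tsq e y.
Proof.
move=> e0; have d0 := tsq_den_gt0 y e0.
have -> : y * dtsq e y = 2 * tsq e y / (1 + e * y ^+ 2).
  by rewrite /dtsq /tsq; field; rewrite gt_eqF.
have t0 := tsq_ge0 y e0.
have t2 : 0 <= 2 * tsq e y by rewrite mulr_ge0.
rewrite ger0_norm ?divr_ge0 ?(ltW d0)//.
by rewrite ler_pdivrMr// ler_peMr// lerDl mulr_ge0// sqr_ge0.
Qed.

Lemma ddtsq_le e y : 0 <= e -> `|ddtsq e y| <= 6.
Proof.
move=> e0; have d0 := tsq_den_gt0 y e0.
rewrite /ddtsq normrM normfV (ger0_norm (exprn_ge0 _ (ltW d0))).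
rewrite ler_pdivrMr ?exprn_gt0//.
have : 0 <= e * y ^+ 2 by rewrite mulr_ge0// sqr_ge0.
rewrite -mulrA; move: (e * _) => u u0.
by rewrite ler_norml; apply/andP; split; nra.
Qed.

(** The one-variable counterpart of [class_C], from which smoothness of functions of a linear form
    is lifted to the plane. *)
Fixpoint smooth1 k phi : Prop :=
  continuous phi /\
  if k is k'.+1 then (forall y, derivable phi y 1) /\ smooth1 k' (derive1 phi)
  else True.

Let ratio e p j y : R := p.[y] / (1 + e * y ^+ 2) ^+ j.

(** The fractions p / (1 + e y^2)^j form a family closed under differentiation, each derivative
    raising j by one; smoothness of every order then follows by induction. *)
Let ratio_derive e p j y : 0 <= e -> is_derive y 1 (ratio e p j)
  (ratio e (p^`() * (1 + e *: 'X^2) - (2 * j%:R * e) *: ('X * p)) j.+1 y).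
Proof.
move=> e0; have d0 := tsq_den_gt0 y e0.
have hp : is_derive y 1 (horner p) p^`().[y].
  by apply: DeriveDef; [exact: derivable_horner|rewrite -derive1E derivE].
have hq : is_derive y 1 (fun z : R => (1 + e * z ^+ 2) ^+ j)
    (j%:R * (1 + e * y ^+ 2) ^+ j.-1 * (e * (2 * y))).
  have hl : is_derive y 1 (fun z : R => 1 + e * z ^+ 2) (e * (2 * y)).
    apply: is_derive_eq; rewrite /GRing.scale/=; ring.
  have := @is_deriveX _ _ (fun z : R => 1 + e * z ^+ 2) j y 1 _ hl.
  rewrite (_ : _ ^+ j = (fun z : R => (1 + e * z ^+ 2) ^+ j)).
    move=> hX; apply: trigger_derive hX _.
    by rewrite /GRing.scale /= mulr_natl; congr (_ * _); ring.
  by apply/funext => z; rewrite exprfctE.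
have qn0 : (1 + e * y ^+ 2) ^+ j != 0 by rewrite expf_neq0// gt_eqF.
have hV := @is_deriveV _ (fun z : R => (1 + e * z ^+ 2) ^+ j) y _ 1 qn0 hq.
have := @is_deriveM _ _ (horner p) (fun z : R => ((1 + e * z ^+ 2) ^+ j)^-1) y 1
  _ _ hp hV.
move=> h; apply: (trigger_derive h).
rewrite /ratio !(hornerE, hornerXn) /GRing.scale /=.
move: (1 + _) d0 {h hV hq qn0 hp} => D D0.
have Dn0 : 1 + e * y * y != 0 by rewrite -mulrA -expr2 gt_eqF// tsq_den_gt0.
(* The power rule leaves the exponent [j.-1], so j = 0 is treated apart. *)
case: j => [|j] /=.
  by rewrite !expr0; field.
by rewrite !exprSr -natr1; field; rewrite Dn0 expf_neq0.
Qed.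

Lemma rational_smooth1 e p j k : 0 <= e ->
  smooth1 k (fun y => p.[y] / (1 + e * y ^+ 2) ^+ j).
Proof.
move=> e0; elim: k p j => [|k IH] p j.
  split=> // y; apply/differentiable_continuous/derivable1_diffP.
  by have [] := ratio_derive p j y e0.
split; first by move=> y; apply/differentiable_continuous/derivable1_diffP;
  have [] := ratio_derive p j y e0.
split; first by move=> y; have [] := ratio_derive p j y e0.
rewrite (_ : derive1 _ = ratio e
  (p^`() * (1 + e *: 'X^2) - (2 * j%:R * e) *: ('X * p)) j.+1); first exact: IH.
by apply/funext => y; rewrite derive1E; have [_ ->] := ratio_derive p j y e0.
Qed.

Lemma tsq_derive e y : 0 <= e -> is_derive y 1 (fun z => 1 + tsq e z) (dtsq e y).
Proof.
move=> e0; have d0 := tsq_den_gt0 y e0.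
(* The numerator comes from 1 + y^2 / (1 + e y^2) = (1 + (e + 1) y^2) / (1 + e y^2). *)
have := ratio_derive (1 + (e + 1) *: 'X^2) 1 y e0.
rewrite (_ : ratio _ _ _ = fun z => 1 + tsq e z); last first.
  apply/funext => z; rewrite /ratio /tsq !(hornerE, hornerXn) expr1 /=.
  have := tsq_den_gt0 z e0; rewrite expr2 mulrA => /lt0r_neq0 ?; by field.
move=> h; apply: (trigger_derive h).
rewrite /ratio /dtsq !(poly.derivE, hornerE, hornerXn) /=.
have := tsq_den_gt0 y e0; rewrite expr2 mulrA => /lt0r_neq0 ?; by field.
Qed.

Lemma dtsq_derive e y : 0 <= e -> is_derive y 1 (dtsq e) (ddtsq e y).
Proof.
move=> e0; have d0 := tsq_den_gt0 y e0.
have := ratio_derive (2 *: 'X) 2 y e0.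
rewrite (_ : ratio _ _ _ = dtsq e); last first.
  by apply/funext => z; rewrite /ratio /dtsq !hornerE /=.
move=> h; apply: (trigger_derive h).
rewrite /ratio /ddtsq !(poly.derivE, hornerE, hornerXn) /=.
have := tsq_den_gt0 y e0; rewrite expr2 mulrA => /lt0r_neq0 ?; by field.
Qed.

Lemma tsq_smooth1 e k : 0 <= e -> smooth1 k (fun y => 1 + tsq e y).
Proof.
move=> e0; rewrite (_ : (fun _ => _) = ratio e (1 + (e + 1) *: 'X^2) 1).
  exact: rational_smooth1.
apply/funext => z; rewrite /ratio /tsq !(hornerE, hornerXn) expr1 /=.
have := tsq_den_gt0 z e0; rewrite expr2 mulrA => /lt0r_neq0 ?; by field.
Qed.

End truncated_square.

(** * Functions of a single linear form in (x, xi) *)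

Section ridge_function.
Variable R : realType.
Implicit Types (phi : R -> R) (a b c : R).

Lemma is_derive_line (f : R * R -> R) (z v : R * R) (df : R) :
  is_derive (0 : R) (1 : R) (fun t : R => f (t *: v + z)) df -> is_derive z v f df.
Proof.
have E : (fun h : R => h^-1 *: ((f \o shift z) (h *: v) - f z)) =
    (fun h : R => h^-1 *: (((fun t : R => f (t *: v + z)) \o shift 0) (h *: 1)
       - f ((0 : R) *: v + z))).
  by apply/funext => h /=; rewrite scaler1 addr0 scale0r add0r.
by move=> [D V]; apply: DeriveDef; rewrite /derivable /derive E.
Qed.

(** The factor c keeps the family closed under partial derivatives: these multiply c by b or a and
    replace phi by its derivative. *)
Let line a b c phi (z : R * R) : R := c * phi (b * z.1 + a * z.2).

Let line_derive a b c phi (z v : R * R) : (forall y, derivable phi y 1) ->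
  is_derive z v (line a b c phi) (line a b (c * (b * v.1 + a * v.2)) (derive1 phi) z).
Proof.
move=> dphi; apply: is_derive_line; rewrite /line /=.
set k := b * v.1 + a * v.2; set l := b * z.1 + a * z.2.
rewrite (_ : (fun t : R => _) = (fun t => c * (phi \o (fun t => t * k + l)) t)).
  have hl : is_derive (0 : R) 1 (fun t : R => t * k + l) k.
    apply: is_derive_eq; rewrite /GRing.scale /=; ring.
  have hp : is_derive ((fun t : R => t * k + l) 0) 1 phi (derive1 phi l).
    rewrite /= mul0r add0r; apply: DeriveDef; first exact: dphi.
    by rewrite derive1E.
  have hc := @is_derive1_comp _ phi (fun t : R => t * k + l) 0 _ _ hp hl.
  have := @is_deriveZ _ _ _ _ c (0 : R) 1 _ hc.
  move=> h; apply: (trigger_derive h); rewrite /GRing.scale /=; ring.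
apply/funext => t /=; congr (c * phi _).
rewrite /k /l /GRing.scale /=; ring.
Qed.

Let line_continuous a b c phi : continuous phi -> continuous (line a b c phi).
Proof.
move=> cphi z; apply: cvgM; first exact: cvg_cst.
apply: continuous_comp; last exact: cphi.
apply: cvgD; apply: cvgM; try exact: cvg_cst.
  exact: cvg_fst. exact: cvg_snd.
Qed.

Lemma d_x_ridge a b c phi : (forall y, derivable phi y 1) ->
  d_x (fun z => c * phi (b * z.1 + a * z.2)) =
  (fun z => c * b * derive1 phi (b * z.1 + a * z.2)).
Proof.
move=> dphi; apply/funext => z; have [_] := line_derive a b c z (1, 0) dphi.
by rewrite /d_x => ->; rewrite /line /= mulr1 mulr0 addr0.
Qed.

Lemma d_xi_ridge a b c phi : (forall y, derivable phi y 1) ->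
  d_xi (fun z => c * phi (b * z.1 + a * z.2)) =
  (fun z => c * a * derive1 phi (b * z.1 + a * z.2)).
Proof.
move=> dphi; apply/funext => z; have [_] := line_derive a b c z (0, 1) dphi.
by rewrite /d_xi => ->; rewrite /line /= mulr1 mulr0 add0r.
Qed.

Lemma class_C_ridge k a b c phi : smooth1 k phi ->
  class_C k (fun z => c * phi (b * z.1 + a * z.2)).
Proof.
elim: k c phi => [|k IH] c phi [cphi].
  by split=> //; exact: (@line_continuous a b c).
move=> [dphi /IH hphi]; split; first exact: (@line_continuous a b c).
split.
- by move=> z; have [] := line_derive a b c z (1, 0) dphi.
- by move=> z; have [] := line_derive a b c z (0, 1) dphi.
- by rewrite d_x_ridge.
- by rewrite d_xi_ridge.
Qed.

End ridge_function.

(** * Domination and the drift *)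

Section integral_bounds.
Context d (T : measurableType d) (R : realType) (mu : {measure set T -> \bar R}).
Implicit Types (D : set T) (f g : T -> R).

(* No measurability is required: the integral of a nonnegative function is a
   supremum over the simple functions below it. *)
Lemma ge0_le_integral_nomeas D (f g : T -> \bar R) :
  (forall x, D x -> 0 <= f x)%E -> (forall x, D x -> f x <= g x)%E ->
  (\int[mu]_(x in D) f x <= \int[mu]_(x in D) g x)%E.
Proof.
move=> f0 fg; have g0 x : D x -> (0 <= g x)%E.
  by move=> Dx; exact: le_trans (f0 _ Dx) (fg _ Dx).
rewrite !ge0_integralE//; apply: le_ereal_sup => _ /= [h hf <-].
exists h => // x; apply: le_trans (hf x) _; rewrite /patch.
by case: ifPn => // /set_mem; exact: fg.
Qed.

(** Integrability is bundled with the bound because [Rintegral] returns the default value 0 when the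
    integral is infinite, so that a bound alone would carry no information. *)
Definition int_le D f K :=
  mu.-integrable D (EFin \o f) /\ \int[mu]_(x in D) f x <= K.

Variables (D : set T) (mD : measurable D).

Lemma int_leD f g K L : int_le D f K -> int_le D g L ->
  int_le D (fun x => f x + g x) (K + L).
Proof.
move=> [fi fK] [gi gL]; split; last by rewrite RintegralD// lerD.
by have := integrableD mD fi gi; apply: eq_integrable => // x _; rewrite EFinD.
Qed.

Lemma int_leZ c f K : 0 <= c -> int_le D f K ->
  int_le D (fun x => c * f x) (c * K).
Proof.
move=> c0 [fi fK]; split; last by rewrite RintegralZl// ler_wpM2l.
by have := integrableZl mD c fi; apply: eq_integrable => // x _; rewrite EFinM.
Qed.

Lemma int_le_trans f K L : K <= L -> int_le D f K -> int_le D f L.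
Proof. by move=> KL [fi fK]; split=> //; exact: le_trans KL. Qed.

(** The third conclusion, in the extended reals, is the form in which absolute convergence of the
    weak equation is checked. *)
Lemma int_le_dominated f g K : measurable_fun D f ->
  (forall x, D x -> `|f x| <= g x) -> int_le D g K ->
  [/\ mu.-integrable D (EFin \o f), `|\int[mu]_(x in D) f x| <= K &
      (\int[mu]_(x in D) `|f x|%:E <= K%:E)%E].
Proof.
move=> mf fg [gi gK].
have fi : mu.-integrable D (EFin \o f).
  apply: le_integrable gi => //; first exact/measurable_EFinP.
  by move=> x Dx; rewrite lee_fin (le_trans (fg _ Dx))// ler_norm.
have afi : mu.-integrable D (EFin \o (fun x => `|f x|)) by exact: integrable_norm.
have abs_le : \int[mu]_(x in D) `|f x| <= K.
  by apply: le_trans gK; exact: le_Rintegral.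
split=> //; first by apply: le_trans abs_le; exact: le_normr_Rintegral.
rewrite -[leLHS]fineK ?lee_fin//.
exact: (integrable_fin_num mD afi).
Qed.

Lemma int_le_ge0P f K : measurable_fun D f -> (forall x, D x -> 0 <= f x) ->
  (\int[mu]_(x in D) (f x)%:E <= K%:E)%E -> int_le D f K.
Proof.
move=> mf f0 fK; have fi : mu.-integrable D (EFin \o f).
  apply/integrableP; split; first exact/measurable_EFinP.
  rewrite (eq_integral (EFin \o f)) ?(le_lt_trans fK) ?ltry// => x /set_mem Dx.
  by rewrite /= ger0_norm// f0.
by split=> //; rewrite -lee_fin fineK//; exact: (integrable_fin_num mD fi).
Qed.

Lemma int_le_mono f g K : measurable_fun D f ->
  (forall x, D x -> 0 <= f x <= g x) -> int_le D g K -> int_le D f K.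
Proof.
move=> mf fg gK; have [|fi + _] := int_le_dominated mf _ gK.
  by move=> x /fg/andP[f0 fgx]; rewrite ger0_norm.
by move=> fK; split=> //; exact: le_trans (ler_norm _) fK.
Qed.

Lemma Rintegral_cvg (f_ : nat -> T -> R) f g :
  (forall n, measurable_fun D (f_ n)) -> measurable_fun D f ->
  (forall x, D x -> f_ n x @[n --> \oo] --> f x) ->
  mu.-integrable D (EFin \o g) -> (forall n x, D x -> `|f_ n x| <= g x) ->
  \int[mu]_(x in D) f_ n x @[n --> \oo] --> \int[mu]_(x in D) f x.
Proof.
move=> mf_ mf f_f gi f_g.
have [fi _ h] := @dominated_convergence _ _ _ mu D mD
  (fun n => EFin \o f_ n) (EFin \o f) (EFin \o g)
  (fun n => (measurable_EFinP _ _).2 (mf_ n)) ((measurable_EFinP _ _).2 mf)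
  ltac:(by apply: aeW => x Dx; apply: cvg_EFin; [exact: nearW|exact: f_f]) gi
  ltac:(by apply: aeW => x n Dx; rewrite lee_fin; exact: f_g).
apply: fine_cvg; rewrite fineK//; exact: (integrable_fin_num mD fi).
Qed.

End integral_bounds.

Ltac measurable_tac := repeat first
  [ assumption | exact: measurable_cst | exact: measurable_fst | exact: measurable_snd
  | exact: measurable_id
  | apply: measurable_funB | apply: measurable_funD | apply: measurable_funM
  | apply: measurable_funX ].

Lemma normM_le_sqr (R : realFieldType) (x y : R) :
  `|x * y| <= 2^-1 * (x ^+ 2 + y ^+ 2).
Proof.
have := (sqr_ge0 (x + y), sqr_ge0 (x - y)) => -[? ?].
by rewrite ler_norml; apply/andP; split; lra.
Qed.

(** The weights 1 and 1/4 are matched to [dtsq_sqr_le]: with y the derivative of the truncation, y^2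
    / 4 is at most the truncated square. *)
Lemma normM_le_sqr4 (R : realFieldType) (x y : R) :
  `|x * y| <= x ^+ 2 + y ^+ 2 / 4.
Proof.
have := (sqr_ge0 (x + y / 2), sqr_ge0 (x - y / 2)) => -[? ?].
by rewrite ler_norml; apply/andP; split; lra.
Qed.

(** * Bounds on the cosine and the drift from second moments *)

Section second_moments.
Variable R : realType.
Implicit Types (m : probability (R * R)%type R) (f g p : R * R -> R).

Let bound m f K := int_le m setT f K.

Lemma bound_cst m K : bound m (fun=> K) K.
Proof.
split; first exact: finite_measure_integrable_cst.
rewrite Rintegral_cst// [X in K * X](_ : _ = 1) ?mulr1//.
exact: (congr1 fine (probability_setT m)).
Qed.

Lemma lambda_of_sqr m :
  m.-integrable setT (EFin \o (fun z : R * R => z.1 ^+ 2)) ->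
  lambda_of m ^+ 2 = bracket (fun z => z.1 ^+ 2) m.
Proof.
by move=> mi; rewrite sqr_sqrtr// Rintegral_ge0// => z _; exact: sqr_ge0.
Qed.

(** An infinite second moment is turned into 0 by [fine], so a nonzero lambda certifies that it is
    finite. *)
Lemma lambda_of_neq0 m : lambda_of m != 0 ->
  m.-integrable setT (EFin \o (fun z : R * R => z.1 ^+ 2)).
Proof.
move=> h; have mf : measurable_fun setT (fun z : R * R => z.1 ^+ 2).
  by measurable_tac.
apply/integrableP; split; first exact/measurable_EFinP.
rewrite (eq_integral (fun z : R * R => (z.1 ^+ 2)%:E)); last first.
  by move=> z _; rewrite /= ger0_norm// sqr_ge0.
rewrite ltey; apply: contraNN h => /eqP h.
by rewrite /lambda_of /bracket /Rintegral h /= sqrtr0.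
Qed.

(* [lambda_of m] is 0 when the second moment is infinite, and division by 0
   gives 0, so no integrability is needed. *)
Lemma bound_scaled_sqr m : bound m (fun z => (z.1 / lambda_of m) ^+ 2) 1.
Proof.
have [->|l0] := eqVneq (lambda_of m) 0.
  rewrite (_ : (fun _ => _) = fun=> 0); last first.
    by apply/funext => z; rewrite invr0 mulr0 expr0n.
  exact: int_le_trans ler01 (bound_cst m 0).
have xi := lambda_of_neq0 l0.
rewrite (_ : (fun _ => _) = fun z => (lambda_of m) ^- 2 * z.1 ^+ 2).
  rewrite -(mulVf (expf_neq0 2 l0)); apply: int_leZ => //.
    by rewrite invr_ge0 sqr_ge0.
  by split; rewrite ?lambda_of_sqr.
by apply/funext => z; rewrite expr_div_n mulrC.
Qed.

Lemma cosine_of_le m V : bound m (fun z => z.2 ^+ 2) V ->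
  `|cosine_of m| <= (1 + V) / 2.
Proof.
move=> xiV; have V0 : 0 <= V.
  by apply: le_trans xiV.2; apply: Rintegral_ge0 => z _; exact: sqr_ge0.
have [l0|l0] := eqVneq (lambda_of m) 0.
  by rewrite /cosine_of l0 invr0 mulr0 normr0 divr_ge0// addr_ge0.
have h := @int_le_dominated _ _ _ m setT measurableT
  (fun z => z.1 / lambda_of m * z.2)
  (fun z => 2^-1 * ((z.1 / lambda_of m) ^+ 2 + z.2 ^+ 2)) (2^-1 * (1 + V)).
have [] := h.
- by measurable_tac.
- by move=> z _; exact: normM_le_sqr.
- apply: int_leZ; rewrite ?invr_ge0//.
  by apply: int_leD => //; exact: bound_scaled_sqr.
move=> _ + _; rewrite mulrC; apply: le_trans; rewrite le_eqVlt; apply/orP; left.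
apply/eqP; congr (`|_|); rewrite /cosine_of.
have xyi : m.-integrable setT (EFin \o (fun z : R * R => z.1 * z.2)).
  have [] // := @int_le_dominated _ _ _ m setT measurableT
    (fun z => z.1 * z.2) (fun z => 2^-1 * (z.1 ^+ 2 + z.2 ^+ 2))
    (2^-1 * (lambda_of m ^+ 2 + V)).
  + by measurable_tac.
  + by move=> z _; exact: normM_le_sqr.
  + apply: int_leZ; rewrite ?invr_ge0//; apply: int_leD => //; split.
      exact: lambda_of_neq0.
    by rewrite lambda_of_sqr//; exact: lambda_of_neq0.
rewrite mulrC /bracket -RintegralZl//; apply: eq_Rintegral => z _.
by rewrite mulrCA mulrA.
Qed.

(** The three summands of K match the three terms of the drift. The bound v on |x p| is left as a
    hypothesis because it is met in two ways: by twice the truncated moment during the Gronwall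
    argument, and by x^2 + p^2 / 4 once second moments are bounded. *)
Lemma drift_bound (tau om : R) m p V u v : 0 <= tau -> 0 <= om ->
  measurable_fun setT p ->
  bound m (fun z => z.2 ^+ 2) V -> bound m (fun z => p z ^+ 2 / 4) u ->
  bound m (fun z => `|z.1 * p z|) v ->
  let K := tau * (om * ((1 + V) / 2) * (V + u) + (1 + u) + v) in
  let G := fun z => drift tau om z.1 (lambda_of m) z.2 (cosine_of m) * p z in
  [/\ m.-integrable setT (EFin \o G), `|bracket G m| <= K &
      (\int[m]_z `|G z|%:E <= K%:E)%E].
Proof.
move=> tau0 om0 mp xiV pu xpv K G.
have Qq := cosine_of_le xiV.
set q := (1 + V) / 2 in K Qq *.
have q0 : 0 <= q by exact: le_trans Qq.
apply: (@int_le_dominated _ _ _ m setT measurableT G (fun z => tau *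
  (om * q * (z.2 ^+ 2 + p z ^+ 2 / 4) +
   ((z.1 / lambda_of m) ^+ 2 + p z ^+ 2 / 4) + `|z.1 * p z|))).
- by rewrite /G /drift; measurable_tac.
- clearbody q; move=> z _; rewrite /G /drift.
  move: (lambda_of m) (cosine_of m) Qq => l Q Qq.
  rewrite -mulrA normrM (ger0_norm tau0) ler_wpM2l//.
  rewrite !mulrDl; apply: le_trans (ler_normD _ _) _.
  rewrite mulNr normrN lerD2r; apply: le_trans (ler_normD _ _) _.
  apply: lerD; last first.
    exact: normM_le_sqr4.
  rewrite -[om * Q * z.2 * p z]mulrA -[om * Q * (_ * _)]mulrA -[om * q * _]mulrA.
  rewrite normrM (ger0_norm om0) ler_wpM2l// normrM.
  by apply: ler_pM => //; exact: normM_le_sqr4.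
- apply: int_leZ => //; apply: int_leD => //; apply: int_leD => //.
    by apply: int_leZ => //; [exact: mulr_ge0|exact: int_leD].
  by apply: int_leD => //; exact: bound_scaled_sqr.
Qed.

(** This takes Q and 1 / lambda out of the integral, so that measurability in time can be checked
    factor by factor and the drift of lambda^2 can be computed. *)
Lemma bracket_drift (tau om : R) m p :
  m.-integrable setT (EFin \o p) ->
  m.-integrable setT (EFin \o (fun z => z.1 * p z)) ->
  m.-integrable setT (EFin \o (fun z => z.2 * p z)) ->
  bracket (fun z => drift tau om z.1 (lambda_of m) z.2 (cosine_of m) * p z) m =
  tau * (om * cosine_of m * bracket (fun z => z.2 * p z) m +
         (lambda_of m)^-1 * bracket (fun z => z.1 * p z) m -
         bracket (fun z => z.1 * p z) m).
Proof.
move=> pi xpi xipi.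
have Zi c f : m.-integrable setT (EFin \o f) ->
    m.-integrable setT (EFin \o (fun z => c * f z)).
  move=> fi; have := integrableZl measurableT c fi.
  by apply: eq_integrable => // x _; rewrite EFinM.
have Di f g : m.-integrable setT (EFin \o f) -> m.-integrable setT (EFin \o g) ->
    m.-integrable setT (EFin \o (fun z => f z + g z)).
  move=> fi gi; have := integrableD measurableT fi gi.
  by apply: eq_integrable => // x _; rewrite EFinD.
have Bi f g : m.-integrable setT (EFin \o f) -> m.-integrable setT (EFin \o g) ->
    m.-integrable setT (EFin \o (fun z => f z - g z)).
  move=> fi gi; have := integrableB measurableT fi gi.
  by apply: eq_integrable => // x _; rewrite EFinB.
rewrite /bracket -!RintegralZl// -RintegralD//; [|exact: Zi..].
rewrite -RintegralB//; last by apply: Di; exact: Zi.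
rewrite -RintegralZl//; last by apply: Bi => //; apply: Di; exact: Zi.
apply: eq_Rintegral => z _; rewrite /drift; ring.
Qed.

End second_moments.

(** * Measurability in time *)

Section right_continuous_functions.
Variable R : realType.

Lemma measurable_comp_floor (w : int -> R) :
  measurable_fun setT (fun s : R => w (Num.floor s)).
Proof.
move=> _ B mB; rewrite setTI.
rewrite (_ : _ @^-1` B = \bigcup_(k in [set k | B (w k)]) 
    [set` `[k%:~R : R, (k + 1)%:~R[]).
  rewrite bigcup_mkcond; apply: countable_bigcupT_measurable => //.
  by move=> k; case: ifPn => // _; exact: measurable_itv.
apply/seteqP; split => [s /= Bs|s [k /= Bk]].
  by exists (Num.floor s) => //=; rewrite in_itv /= floor_itv.
by rewrite in_itv /= => /floor_def ->.
Qed.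

(* v is the pointwise limit of its right-end samplings on grids of mesh 1/n. *)
Lemma right_continuous_measurable (v : R -> R) :
  (forall s, v x @[x --> s^'+] --> v s) -> measurable_fun setT v.
Proof.
move=> rv.
(* The [+ 1] puts the sampling point strictly to the right of s even when s lies on the grid, as a
   right limit demands. *)
pose h (n : nat) (s : R) := v ((Num.floor (n.+1%:R * s) + 1)%:~R / n.+1%:R).
apply: (@measurable_fun_cvg _ _ _ setT h v).
  move=> n.
  apply: (measurableT_comp
    (measurable_comp_floor (fun k => v ((k + 1)%:~R / n.+1%:R)))).
  by apply: measurable_funM => //; exact: measurable_cst.
move=> s _; have /cvg_at_rightP rs := rv s.
apply: (rs (fun n => (Num.floor (n.+1%:R * s) + 1)%:~R / n.+1%:R)); split.
  move=> n; rewrite ltr_pdivlMr// mulrC.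
  by have /andP[] := floor_itv (n.+1%:R * s).
apply: (@squeeze_cvgr _ _ _ _ (fun=> s) (fun n => s + n.+1%:R^-1)).
- apply: nearW => n; have /andP[fl fu] := floor_itv (n.+1%:R * s).
  rewrite ler_pdivlMr// mulrC (ltW fu) /= ler_pdivrMr// mulrDl mulVf//.
  by rewrite rmorphD /= lerD2r [s * _]mulrC.
- exact: cvg_cst.
- rewrite -[X in _ --> X]addr0; apply: cvgD; first exact: cvg_cst.
  exact: cvg_harmonic.
Qed.

End right_continuous_functions.

Section weak_continuity.
Variable R : realType.
Implicit Types (f : R * R -> R).

Lemma continuous_bracket (g : bounded_continuous R) :
  continuous (fun m : measR2 R => bracket g m).
Proof.
move=> m; apply: (@continuous_comp _ _ _ (@integrals R : measR2 R -> _)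
  (@proj {classic bounded_continuous R} (fun=> R) g)).
  exact: initial_continuous.
exact: (@proj_continuous {classic bounded_continuous R} (fun=> R) g).
Qed.

Variable mu : skorokhod R (measR2 R).

Lemma measurable_bracket_bounded f : continuous f ->
  (exists M, forall z, `|f z| <= M) ->
  measurable_fun setT (fun s => bracket f (mu s)).
Proof.
move=> cf bf; apply: right_continuous_measurable => s.
have cb := @continuous_bracket (BoundedContinuous cf bf).
have [s0|s0] := leP 0 s.
  exact: (@cvg_comp _ _ _ (mu : R -> measR2 R) (fun m : measR2 R => bracket f m) _ _ _
    (@path_right _ _ mu s s0) (cb (mu s))).
apply: cvg_near_cst; near=> x; rewrite (@path_neg _ _ mu s s0) (@path_neg _ _ mu x)//.
Unshelve. all: by end_near. Qed.

(** The weak topology does not see unbounded integrands such as x^2. Clipping f to [-n, n] gives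
    bounded continuous functions dominated by |f|, whose brackets converge to that of f at each
    time. *)
Lemma measurable_bracket f : continuous f -> measurable_fun setT f ->
  (forall s, (mu s : probability (R * R)%type R).-integrable setT (EFin \o f)) ->
  measurable_fun setT (fun s => bracket f (mu s)).
Proof.
move=> cf mf fi.
pose g (n : nat) z := Num.max (- n%:R) (Num.min n%:R (f z)).
have g_le n z : `|g n z| <= `|f z|.
  have := ler0n R n; rewrite /g; move: (f z) n%:R => x N N0.
  have [x0|/ltW x0] := leP 0 x.
    have h : 0 <= Num.min N x by rewrite le_min N0.
    rewrite (max_idPr _) ?(le_trans _ h) ?oppr_le0//.
    by rewrite ger0_norm// ge_min ler_norm orbT.
  rewrite (min_idPr _) ?(le_trans x0)// ler0_norm ?ge_max ?oppr_le0 ?N0//.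
  by rewrite ler0_norm// lerN2 le_max lexx orbT.
apply: (@measurable_fun_cvg _ _ _ setT (fun n s => bracket (g n) (mu s))).
  move=> n; apply: measurable_bracket_bounded.
    move=> z; apply: (@continuous_max _ _ (fun=> - n%:R)
      (fun z => Num.min n%:R (f z))); first exact: cvg_cst.
    by apply: (@continuous_min _ _ (fun=> n%:R) f); [exact: cvg_cst|exact: cf].
  exists n%:R => z; rewrite /g ler_norml le_max lexx /= ge_max ge_min lexx /= andbT.
  by rewrite (@le_trans _ _ 0)// oppr_le0.
move=> s _; apply: (@Rintegral_cvg _ _ _ _ setT measurableT g f (fun z => `|f z|)).
- by move=> n; apply: measurable_maxr => //; apply: measurable_minr.
- exact: mf.
- move=> z _; apply: cvg_near_cst; near=> n.
  have fn : `|f z| <= n%:R by near: n; exact: nbhs_infty_ger.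
  move: fn; rewrite ler_norml /g => /andP[f1 f2].
  by rewrite (min_idPr f2) (max_idPr f1).
- exact: (integrable_norm (fi s)).
- by move=> n z _.
Unshelve. all: by end_near. Qed.

End weak_continuity.

(** * Initial moments *)

Section empirical_brackets.
Variable R : realType.

Lemma bracket_emp n (x xi : 'cV[R]_n.+1) (f : R * R -> R) :
  measurable_fun setT f -> (forall z, 0 <= f z) ->
  bracket f (emp x xi) = n.+1%:R^-1 * \sum_(i < n.+1) f (x i 0, xi i 0).
Proof.
move=> mf f0.
have n0 : (0 : R) <= n.+1%:R^-1 by rewrite invr_ge0.
(* [msum] is indexed by natural numbers, hence the detour through [inord]. *)
pose dir (i : nat) : {measure set (R * R)%type -> \bar R} :=
  dirac (x (inord i) 0, xi (inord i) 0).
have mfE : measurable_fun setT (EFin \o f) by exact/measurable_EFinP.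
have f0E (z : R * R) : setT z -> (0 <= (EFin \o f) z)%E by rewrite lee_fin.
rewrite /bracket /Rintegral.
rewrite (eq_measure_integral (mscale (NngNum n0) (msum dir n.+1))); last first.
  move=> A mA _; rewrite /= /empirical /mscale /msum /=.
  by congr (_ * _)%E; apply: eq_bigr => i _; rewrite /dir inord_val.
rewrite ge0_integral_mscale// ge0_integral_measure_sum//.
rewrite (eq_bigr (fun i : 'I_n.+1 => (f (x i 0, xi i 0))%:E)).
  by rewrite sumEFin -EFinM.
by move=> i _; rewrite integral_dirac// diracT mul1e /= inord_val.
Qed.

End empirical_brackets.

Section random_elements.
Context d (Om : measurableType d) (R : realType) (P : probability Om R).

Lemma random_element_measurable (U : topologicalType) (X : Om -> U) (G : U -> R) :
  random_element X -> continuous G -> measurable_fun setT (G \o X).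
Proof.
move=> mX cG; apply: (measurability _ (RGenOInfty.measurableE R)).
move=> _ [_ [c ->]] <-; apply: mX; exists (G @^-1` `]c, +oo[%classic); rewrite ?setTI//.
apply: sub_sigma_algebra; move/continuousP : cG; apply; exact: interval_open.
Qed.

(** The bounds hold only almost surely. Clipping f to [c, C] changes it on a null set and makes it
    bounded everywhere, hence integrable. *)
Lemma ae_bounded_Rintegral (f : Om -> R) (c C : R) : measurable_fun setT f ->
  {ae P, forall w, c <= f w <= C} -> c <= \int[P]_w f w <= C.
Proof.
move=> mf fcC; pose g w := Num.max c (Num.min C (f w)).
have P0 : (0 < P setT)%E.
  by have PT := probability_setT P; rewrite [X in (_ < X)%E]PT lte01.
have cC : c <= C.
  (* The space has positive mass, so some point satisfies both bounds, which forces c <= C. *)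
  have [w] := @filter_ex _ _ (ae_properfilter_algebraOfSetsType P0) _ fcC.
  by move=> /andP[/le_trans]; apply.
have cst_le K : \int[P]_w K = K.
  rewrite Rintegral_cst// [X in K * X](_ : _ = 1) ?mulr1//.
  exact: (congr1 fine (probability_setT P)).
have gi : P.-integrable setT (EFin \o g).
  apply: measurable_bounded_integrable => //.
  - by rewrite [X in (X < _)%E](probability_setT P) ltry.
  - by apply: measurable_maxr => //; apply: measurable_minr.
  - exists (`|c| + `|C|); split=> // K cCK w _; apply: le_trans (ltW cCK).
    rewrite /g ler_norml le_max ge_max ge_min.
    have := (ler_norm (- c), ler_norm C, normr_ge0 c, normr_ge0 C).
    rewrite normrN => -[[[h1 h2] h3] h4].
    apply/andP; split; first by apply/orP; left; lra.
    by apply/andP; split; [lra|apply/orP; left; lra].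
have -> : \int[P]_w f w = \int[P]_w g w.
  congr fine; apply: ae_eq_integral => //.
  - exact/measurable_EFinP.
  - by have /integrableP[] := gi.
  - apply: filterS fcC => w /andP[h1 h2] _.
    by rewrite /= /g (min_idPr h2) (max_idPr h1).
have Ki K : P.-integrable setT (EFin \o (fun=> K)) by
  exact: finite_measure_integrable_cst.
rewrite -[X in X <= _ <= _]cst_le -[X in _ <= _ <= X]cst_le; apply/andP; split.
  by apply: le_Rintegral => // w _; rewrite /g le_max lexx.
by apply: le_Rintegral => // w _; rewrite /g ge_max cC ge_min lexx.
Qed.

End random_elements.

Section initial_condition.
Context (R : realType) (d : nat -> measure_display)
  (Om : forall p, measurableType (d p)) (P : forall p, probability (Om p) R)
  (xi : forall p, 'cV[R]_p.+1) (x0 : forall p, Om p -> 'cV[R]_p.+1)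
  (m : measR2 R).
Hypothesis x0_random : forall p, random_element (@x0 p).
Hypothesis x0_cvg :
  weak_cvg_to_point P (fun p w => emp (@x0 p w) (xi p)) m.

(** For bounded continuous f, the bracket of f is itself a bounded continuous functional on
    measures, hence admissible in the weak convergence of the random empirical measures. Its
    expectations stay in [c, C], and so does their limit. *)
Lemma limit_bracket_bounds (f : R * R -> R) (c C M : R) :
  continuous f -> measurable_fun setT f -> (forall z, 0 <= f z <= M) ->
  (forall p, {ae P p, forall w, c <= bracket f (emp (@x0 p w) (xi p)) <= C}) ->
  c <= bracket f m <= C.
Proof.
move=> cf mf f0M fcC; have f0 z : 0 <= f z by have /andP[] := f0M z.
have bf : exists M, forall z, `|f z| <= M.
  by exists M => z; rewrite ger0_norm//; have /andP[] := f0M z.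
have brM (k : measR2 R) : `|bracket f k| <= M.
  have [||_ + _] := @int_le_dominated _ _ _ k setT measurableT f (fun=> M) M mf.
  - by move=> z _; rewrite ger0_norm//; have /andP[] := f0M z.
  - exact: bound_cst.
  - exact: id.
have cvg_f := x0_cvg (@continuous_bracket _ (BoundedContinuous cf bf))
  (ex_intro _ M brM).
have bnd p : c <= \int[P p]_w bracket f (emp (@x0 p w) (xi p)) <= C.
  apply: ae_bounded_Rintegral (fcC p).
  (* The bracket is a continuous function of the random vector, so it is measurable in w. *)
  pose G (x : 'cV[R]_p.+1) := p.+1%:R^-1 * \sum_(i < p.+1) f (x i 0, xi p i 0).
  rewrite (_ : (fun _ => _) = G \o @x0 p); last first.
    by apply/funext => w; rewrite /= bracket_emp.
  apply: random_element_measurable => // x.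
  apply: (@cvgM _ _ (nbhs x) _ (fun=> p.+1%:R^-1)
    (fun x : 'cV[R]_p.+1 => \sum_(i < p.+1) f (x i 0, xi p i 0))).
    exact: cvg_cst.
  apply: cvg_big => [|i _]; first exact: add_continuous.
  apply: (@continuous_comp _ _ _ (fun x : 'cV[R]_p.+1 => (x i 0, xi p i 0)) f);
    last exact: cf.
  have hx : (fun x : 'cV[R]_p.+1 => x i 0) @ x --> x i 0.
    exact: coord_continuous.
  have hxi : (fun _ : 'cV[R]_p.+1 => xi p i 0) @ x --> xi p i 0.
    have FF : Filter (nbhs x) := nbhs_filter x.
    exact: (@cvg_cst _ _ _ (nbhs x) FF).
  exact: (cvg_pair hx hxi).
apply/andP; split.
  by apply: (cvgr_to_ge cvg_f); apply: nearW => p; have /andP[] := bnd p.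
by apply: (cvgr_to_le cvg_f); apply: nearW => p; have /andP[] := bnd p.
Qed.

End initial_condition.

(** * Truncated moments and the limit e = 1 / (n + 1) *)

Section truncated_moments.
Variable R : realType.
Implicit Types (m : probability (R * R)%type R) (a b e : R).

Lemma tsq_continuous e : 0 <= e -> continuous (tsq e).
Proof.
move=> e0 y; apply: cvgM; first exact: exprn_continuous.
apply: cvgV; first by rewrite gt_eqF// tsq_den_gt0.
apply: cvgD; first exact: cvg_cst.
by apply: cvgM; [exact: cvg_cst|exact: exprn_continuous].
Qed.

Lemma dtsq_continuous e : 0 <= e -> continuous (dtsq e).
Proof.
move=> e0 y; apply/differentiable_continuous/derivable1_diffP.
by have [] := dtsq_derive y e0.
Qed.

Lemma ddtsq_continuous e : 0 <= e -> continuous (ddtsq e).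
Proof.
move=> e0; have [_ [_ [_ [_ [+ _]]]]] := tsq_smooth1 2 e0.
rewrite (_ : derive1 (fun y => 1 + tsq e y) = dtsq e).
  rewrite (_ : derive1 (dtsq e) = ddtsq e)//.
  by apply/funext => y; rewrite derive1E; have [_ ->] := dtsq_derive y e0.
by apply/funext => y; rewrite derive1E; have [_ ->] := tsq_derive y e0.
Qed.

Lemma linear_continuous2 a b : continuous (fun z : R * R => b * z.1 + a * z.2).
Proof.
by move=> z; apply: cvgD; apply: cvgM; try exact: cvg_cst;
  [exact: cvg_fst|exact: cvg_snd].
Qed.

Lemma measurable_linear a b :
  measurable_fun setT (fun z : R * R => b * z.1 + a * z.2).
Proof. by measurable_tac. Qed.

Lemma continuous_comp_linear a b (h : R -> R) : continuous h ->
  continuous (fun z : R * R => h (b * z.1 + a * z.2)).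
Proof.
move=> ch z; apply: (@continuous_comp _ _ _ (fun z : R * R => b * z.1 + a * z.2) h).
  exact: linear_continuous2.
exact: ch.
Qed.

Lemma measurable_comp_linear a b (h : R -> R) : continuous h ->
  measurable_fun setT (fun z : R * R => h (b * z.1 + a * z.2)).
Proof.
move=> ch; apply: (measurableT_comp (continuous_measurable_fun ch)).
exact: measurable_linear.
Qed.

Lemma cvg_tsq_den (y : R) k :
  (1 + n.+1%:R^-1 * y ^+ 2) ^+ k @[n --> \oo] --> (1 : R).
Proof.
rewrite -[X in _ --> X](expr1n _ k).
have h : 1 + n.+1%:R^-1 * y ^+ 2 @[n --> \oo] --> (1 : R).
  rewrite -[X in _ --> X]addr0; apply: cvgD; first exact: cvg_cst.
  rewrite -[X in _ --> X](mul0r (y ^+ 2)).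
  by apply: cvgM; [exact: cvg_harmonic|exact: cvg_cst].
exact: (cvg_comp _ _ h (@exprn_continuous _ k 1)).
Qed.

Lemma cvg_tsq (y : R) : tsq n.+1%:R^-1 y @[n --> \oo] --> y ^+ 2.
Proof.
rewrite /tsq -[X in _ --> X]divr1; apply: cvgM; first exact: cvg_cst.
by apply: cvgV; [exact: oner_neq0|exact: (cvg_tsq_den _ 1)].
Qed.

Lemma cvg_dtsq (y : R) : dtsq n.+1%:R^-1 y @[n --> \oo] --> 2 * y.
Proof.
rewrite /dtsq -[X in _ --> X]divr1; apply: cvgM; first exact: cvg_cst.
by apply: cvgV; [exact: oner_neq0|exact: cvg_tsq_den].
Qed.

Lemma cvg_ddtsq (y : R) : ddtsq n.+1%:R^-1 y @[n --> \oo] --> (2 : R).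
Proof.
rewrite /ddtsq -[X in _ --> X]divr1; apply: cvgM; last first.
  by apply: cvgV; [exact: oner_neq0|exact: cvg_tsq_den].
rewrite -[X in _ --> X]subr0; apply: cvgB; first exact: cvg_cst.
rewrite -[X in _ --> X](mul0r (y ^+ 2)); apply: cvgM; last exact: cvg_cst.
rewrite -[X in _ --> X](mulr0 6); apply: cvgM; first exact: cvg_cst.
exact: cvg_harmonic.
Qed.

Lemma tsq_antitone e1 e2 (y : R) : 0 <= e1 -> e1 <= e2 -> tsq e2 y <= tsq e1 y.
Proof.
move=> e10 e12; have e20 := le_trans e10 e12.
rewrite ler_wpM2l ?sqr_ge0// lef_pV2 ?posrE ?tsq_den_gt0//.
by rewrite lerD2l ler_wpM2r// sqr_ge0.
Qed.

Lemma tsq_integrable a b m e : 0 < e ->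
  m.-integrable setT (EFin \o (fun z => tsq e (b * z.1 + a * z.2))).
Proof.
move=> e0; have [] // := @int_le_dominated _ _ _ m setT measurableT
  (fun z => tsq e (b * z.1 + a * z.2)) (fun=> e^-1) e^-1.
- by apply: measurable_comp_linear; exact/tsq_continuous/ltW.
- by move=> z _; rewrite ger0_norm ?tsq_le_inv// tsq_ge0// ltW.
- exact: bound_cst.
Qed.

(** The truncations increase to the square as e decreases, so monotone convergence applies.
    Finiteness of the second moment is an outcome here, not an assumption. *)
Lemma tsq_fatou a b m K :
  (forall n, bracket (fun z => tsq n.+1%:R^-1 (b * z.1 + a * z.2)) m <= K) ->
  int_le m setT (fun z => (b * z.1 + a * z.2) ^+ 2) K.
Proof.
move=> hK; have e0 n : (0 : R) <= n.+1%:R^-1 by rewrite invr_ge0.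
pose l (z : R * R) := b * z.1 + a * z.2.
have ml n : measurable_fun setT (fun z => (tsq n.+1%:R^-1 (l z))%:E).
  by apply/measurable_EFinP; apply: measurable_comp_linear; exact: tsq_continuous.
apply: int_le_ge0P => //.
- by apply: measurable_funX; exact: measurable_linear.
- by move=> z _; exact: sqr_ge0.
have lim_sqr z : limn (fun n => (tsq n.+1%:R^-1 (l z))%:E) = (l z ^+ 2)%:E.
  by apply/cvg_lim => //; apply: cvg_EFin; [exact: nearW|exact: cvg_tsq].
rewrite -(eq_integral _ _ (fun z _ => lim_sqr z)).
have h : (\int[m]_z (tsq n.+1%:R^-1 (l z))%:E @[n --> \oo] -->
    \int[m]_z limn (fun n => (tsq n.+1%:R^-1 (l z))%:E))%E.
  apply: cvg_monotone_convergence => //.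
  - by move=> n z _; rewrite lee_fin tsq_ge0.
  - by move=> z _ n k nk; rewrite lee_fin tsq_antitone// lef_pV2 ?posrE// ler_nat.
apply: (cvge_to_le h); apply: nearW => n.
rewrite -[leLHS]fineK; first by rewrite lee_fin; exact: hK.
by apply: (integrable_fin_num measurableT); exact: tsq_integrable.
Qed.

End truncated_moments.

Section initial_moments.
Context (R : realType) (d : nat -> measure_display)
  (Om : forall p, measurableType (d p)) (P : forall p, probability (Om p) R)
  (xi : forall p, 'cV[R]_p.+1) (x0 : forall p, Om p -> 'cV[R]_p.+1)
  (m : measR2 R).
Hypothesis x0_random : forall p, random_element (@x0 p).
Hypothesis x0_cvg :
  weak_cvg_to_point P (fun p w => emp (@x0 p w) (xi p)) m.

Let pow4 (z : R * R) := z.1 ^+ 4 + z.2 ^+ 4.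

Let bracket_pow4 n (x y : 'cV[R]_n.+1) :
  bracket pow4 (emp x y) = n.+1%:R^-1 * \sum_(i < n.+1) (x i 0 ^+ 4 + y i 0 ^+ 4).
Proof.
rewrite bracket_emp//; first by rewrite /pow4; measurable_tac.
by move=> z; rewrite addr_ge0// exprn_even_ge0.
Qed.

Let tsq_bracket a b e : 0 < e -> forall n (x y : 'cV[R]_n.+1),
  bracket (fun z => tsq e (b * z.1 + a * z.2)) (emp x y) =
  n.+1%:R^-1 * \sum_(i < n.+1) tsq e (b * x i 0 + a * y i 0).
Proof.
move=> e0 n x y; rewrite bracket_emp//.
  by apply: measurable_comp_linear; exact/tsq_continuous/ltW.
by move=> z; rewrite tsq_ge0// ltW.
Qed.

(** The two choices of (b, a) are the coordinates x and xi. The bound is the same for every e, so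
    the truncation can be removed afterwards. *)
Lemma initial_moment_le (a b e C : R) : 0 < e ->
  (b = 1 /\ a = 0) \/ (b = 0 /\ a = 1) ->
  (forall p, {ae P p, forall w, bracket pow4 (emp (@x0 p w) (xi p)) <= C}) ->
  bracket (fun z => tsq e (b * z.1 + a * z.2)) m <= 1 + C.
Proof.
move=> e0 ab hC; have ct := @tsq_continuous R e (ltW e0).
have bnd p : {ae P p, forall w,
    0 <= bracket (fun z => tsq e (b * z.1 + a * z.2)) (emp (@x0 p w) (xi p)) <= 1 + C}.
  apply: filterS (hC p) => w; rewrite bracket_pow4 tsq_bracket// => h.
  apply/andP; split.
    by rewrite mulr_ge0 ?invr_ge0// sumr_ge0// => i _; rewrite tsq_ge0// ltW.
  apply: le_trans (lerD (lexx 1) h).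
  (* The constant 1 is written as an average of ones, to compare the two sums term by term. *)
  rewrite -[X in X + _](mulVf (_ : p.+1%:R != 0))// -mulrDr ler_wpM2l ?invr_ge0//.
  rewrite -[X in _ <= X%:R + _](card_ord p.+1) -sumr_const -big_split /=.
  apply: ler_sum => i _; apply: le_trans (tsq_le_sqr _ (ltW e0)) _.
  move: (@x0 p w i 0) (xi p i 0) => x y.
  (* Nonnegativity of (y^2 - 1)^2 gives y^2 <= (1 + y^4) / 2, which is the source of 1 + C. *)
  have := (sqr_ge0 (x ^+ 2 - 1), sqr_ge0 (y ^+ 2 - 1), sqr_ge0 x, sqr_ge0 y).
  rewrite !sqrrB -!exprM /= => -[[[h1 h2] h3] h4].
  have [h5 h6] : 0 <= x ^+ 4 /\ 0 <= y ^+ 4 by rewrite !exprn_even_ge0.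
  by case: ab => -[-> ->]; rewrite !(mul0r, mul1r, addr0, add0r); lra.
have tb z : 0 <= tsq e (b * z.1 + a * z.2) <= e^-1.
  by rewrite tsq_ge0 ?(ltW e0) ?tsq_le_inv.
by have /andP[] := limit_bracket_bounds x0_random x0_cvg
  (@continuous_comp_linear _ a b _ ct)
  (@measurable_comp_linear _ a b _ ct) tb bnd.
Qed.

(** Mass escaping to infinity could make the second moment of the limit drop; the fourth moments
    limit the loss to e C. *)
Lemma initial_moment_ge (e b C : R) : 0 < e -> 0 < b ->
  (forall p, {ae P p, forall w, bracket pow4 (emp (@x0 p w) (xi p)) <= C}) ->
  (forall p, {ae P p, forall w, b <= vec_lambda (@x0 p w)}) ->
  b ^+ 2 - e * C <= bracket (fun z => tsq e (1 * z.1 + 0 * z.2)) m.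
Proof.
move=> e0 b0 hC hb; have ct := @tsq_continuous R e (ltW e0).
have bnd p : {ae P p, forall w, b ^+ 2 - e * C <=
    bracket (fun z => tsq e (1 * z.1 + 0 * z.2)) (emp (@x0 p w) (xi p)) <= e^-1}.
  apply: filterS2 (hC p) (hb p) => w; rewrite bracket_pow4 tsq_bracket//.
  move=> h1 h2; apply/andP; split; last first.
    rewrite ler_pdivrMl//.
    rewrite mulr_natl -[X in _ *+ X](card_ord p.+1) -sumr_const.
    by apply: ler_sum => i _; exact: tsq_le_inv.
  have h3 : b ^+ 2 <= p.+1%:R^-1 * \sum_(i < p.+1) @x0 p w i 0 ^+ 2.
    apply: le_trans (_ : vec_lambda (@x0 p w) ^+ 2 <= _).
      by rewrite lerXn2r ?nnegrE// ?(ltW b0)// (le_trans (ltW b0)).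
    rewrite /vec_lambda /norm2 expr_div_n !sqr_sqrtr ?ler0n//.
      by rewrite mulrC.
    by apply: sumr_ge0 => i _; exact: sqr_ge0.
  apply: le_trans (lerB h3 (ler_wpM2l (ltW e0) h1)) _.
  rewrite mulrCA -mulrBr ler_wpM2l ?invr_ge0// mulr_sumr -sumrB.
  apply: ler_sum => i _; apply: le_trans (tsq_ge _ (ltW e0)).
  rewrite mul1r mul0r addr0 lerD2l lerN2 ler_wpM2l ?(ltW e0)// lerDl.
  by rewrite exprn_even_ge0.
have tb z : 0 <= tsq e (1 * z.1 + 0 * z.2) <= e^-1.
  by rewrite tsq_ge0 ?(ltW e0) ?tsq_le_inv.
by have /andP[] := limit_bracket_bounds x0_random x0_cvg
  (@continuous_comp_linear _ 0 1 _ ct)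
  (@measurable_comp_linear _ 0 1 _ ct) tb bnd.
Qed.

End initial_moments.

(** * Integrals over intervals *)

Section interval_integrals.
Variable R : realType.
Local Notation leb := (@lebesgue_measure R).
Implicit Types (f g h u : R -> R).

(** In the Gronwall argument the drift bracket is not yet known to be measurable in time, since that
    rests on the very moment bound being proved. The positive part of f is compared with g; if the
    negative part has infinite integral, the integral of f defaults to 0, and g >= 0 settles that
    case. *)
Lemma le_Rintegral_nomeas d (T : measurableType d) (mu : {measure set T -> \bar R})
    (D : set T) (f g : T -> R) : measurable D ->
  mu.-integrable D (EFin \o g) -> (forall x, D x -> 0 <= g x) ->
  (forall x, D x -> f x <= g x) ->
  \int[mu]_(x in D) f x <= \int[mu]_(x in D) g x.
Proof.
move=> mD gi g0 fg; have gfin := integrable_fin_num mD gi.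
set p := (\int[mu]_(x in D) (EFin \o f)^\+ x)%E.
set n := (\int[mu]_(x in D) (EFin \o f)^\- x)%E.
have fpos : (p <= \int[mu]_(x in D) (g x)%:E)%E.
  apply: ge0_le_integral_nomeas => x Dx; rewrite ?funepos_ge0//.
  by rewrite funeposE ge_max !lee_fin fg// g0.
have p0 : (0 <= p)%E by apply: integral_ge0 => x _; exact: funepos_ge0.
have n0 : (0 <= n)%E by apply: integral_ge0 => x _; exact: funeneg_ge0.
have := Rintegral_ge0 mu g0; move: fpos; rewrite /Rintegral -(fineK gfin) /=.
rewrite [in X in _ -> _ -> fine X <= _]integralE -/p -/n; move: (fine _) => q.
case: p p0 => [p||] //; case: n n0 => [n||] //=.
- by rewrite !lee_fin => ? ? ? ?; lra.
Qed.

Lemma bounded_itv_integrable f (a b K : R) : measurable_fun setT f ->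
  (forall s, a <= s <= b -> `|f s| <= K) -> leb.-integrable `[a, b] (EFin \o f).
Proof.
move=> mf fK; apply: measurable_bounded_integrable => //.
- by rewrite /= lebesgue_measure_itv /=; case: ifPn; rewrite ?ltry// -EFinB ltry.
- exact: measurable_funTS.
- exists K; split=> [|M KM s]; first exact: num_real.
  by rewrite /= in_itv /= => /fK h; exact: le_trans (ltW KM).
Qed.

Lemma Rintegral_itv_cst (a b K : R) : a <= b ->
  \int[leb]_(s in `[a, b]) K = K * (b - a).
Proof.
move=> ab; rewrite Rintegral_cst// /= lebesgue_measure_itv /= lte_fin.
by move: ab; rewrite le_eqVlt => /predU1P[->|->]; rewrite ?ltxx ?subrr.
Qed.

Lemma Rintegral_itv_le f (a b K : R) : a <= b -> measurable_fun setT f ->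
  (forall s, a <= s <= b -> `|f s| <= K) ->
  `|\int[leb]_(s in `[a, b]) f s| <= K * (b - a).
Proof.
move=> ab mf fK; have [|||_ h _ //] := @int_le_dominated _ _ _ leb `[a, b] _ f
  (fun=> K) (K * (b - a)) (measurable_funTS mf).
- exact: measurable_itv.
- by move=> s; rewrite /= in_itv /=; exact: fK.
- split; last by rewrite Rintegral_itv_cst.
  apply: (@bounded_itv_integrable (fun=> K) a b `|K|); first exact: measurable_cst.
  by [].
Qed.

Lemma Rintegral_expR (k t : R) : 0 < k -> 0 <= t ->
  \int[leb]_(s in `[0, t]) expR (k * s) = (expR (k * t) - 1) / k.
Proof.
move=> k0; rewrite le_eqVlt => /predU1P[<-|t0].
  by rewrite set_itv1 Rintegral_set1 mulr0 expR0 subrr mul0r.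
have dF (x : R) : is_derive x (1 : R) (fun s => k^-1 * expR (k * s)) (expR (k * x)).
  apply: is_derive_eq; rewrite /GRing.scale /=.
  by rewrite mulr1 mulrCA mulVf ?mulr1// gt_eqF.
rewrite /Rintegral (@continuous_FTC2 _ _ (fun s => k^-1 * expR (k * s)))//.
- by rewrite mulr0 expR0 -EFinB /=; ring.
- apply: continuous_subspaceT => x.
  apply: continuous_comp; last exact: continuous_expR.
  by apply: cvgM; [exact: cvg_cst|exact: cvg_id].
- have cF (x : R) : {for x, continuous (fun s => k^-1 * expR (k * s))}.
    by apply/differentiable_continuous/derivable1_diffP; have [] := dF x.
  split.
  + by move=> x _; have [] := dF x.
  + exact/cvg_at_right_filter/cF.
  + exact/cvg_at_left_filter/cF.
- by move=> x _; rewrite derive1E; have [_ ->] := dF x.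
Qed.

(* The supremum of u(t) exp(-2 B t) is at most K plus half of itself. *)
Lemma gronwall u (K B T M : R) : 0 <= K -> 0 < B ->
  measurable_fun setT u -> (forall s, 0 <= u s <= M) ->
  (forall t, 0 <= t <= T -> u t <= K + B * \int[leb]_(s in `[0, t]) u s) ->
  forall t, 0 <= t <= T -> u t <= 2 * K * expR (2 * B * t).
Proof.
move=> K0 B0 mu_ uM hu t0 /andP[t00 t0T].
have T0 := le_trans t00 t0T.
pose A := [set u t * expR (- (2 * B * t)) | t in `[0, T]].
have A0 : A (u t0 * expR (- (2 * B * t0))).
  by exists t0 => //=; rewrite in_itv /= t00.
have M0 : 0 <= M by have /andP[/le_trans] := uM 0; apply.
have ubA : ubound A M.
  move=> y [t /=]; rewrite in_itv /= => /andP[t1 t2] <-; have /andP[u0 uM'] := uM t.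
  rewrite -[M]mulr1 ler_pM ?expR_ge0// -expR0 ler_expR oppr_le0.
  by rewrite !mulr_ge0// ltW.
have supA : has_sup A by split; [exists (u t0 * expR (- (2 * B * t0)))|exists M].
have B20 : 0 < 2 * B by rewrite mulr_gt0.
have le_sup t : 0 <= t <= T -> u t <= sup A * expR (2 * B * t).
  move=> tT; rewrite -[X in _ <= _ * X]invrK -expRN ler_pdivlMr ?expR_gt0//.
  by apply: (sup_upper_bound supA); exists t => //=; rewrite in_itv.
have S0 : 0 <= sup A.
  apply: le_trans (sup_upper_bound supA A0).
  by rewrite mulr_ge0 ?expR_ge0//; have /andP[] := uM t0.
have step : sup A <= K + sup A / 2.
  apply: ge_sup; first by case: supA.
  move=> y [t /=]; rewrite in_itv /= => /andP[t1 t2] <-.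
  rewrite expRN ler_pdivrMr ?expR_gt0//.
  have ht : 0 <= t <= T by rewrite t1.
  apply: le_trans (hu t ht) _.
  have : \int[leb]_(s in `[0, t]) u s <= sup A * ((expR (2 * B * t) - 1) / (2 * B)).
    have expi : leb.-integrable `[0, t] (EFin \o (fun s => expR (2 * B * s))).
      apply: (@bounded_itv_integrable _ 0 t (expR (2 * B * t))).
        apply: continuous_measurable_fun => x.
        apply: continuous_comp; last exact: continuous_expR.
        by apply: cvgM; [exact: cvg_cst|exact: cvg_id].
      move=> s /andP[_ s2]; rewrite ger0_norm ?expR_ge0// ler_expR.
      by rewrite ler_pM2l.
    rewrite -Rintegral_expR// -RintegralZl//.
    apply: le_Rintegral => //.
    - apply: (@bounded_itv_integrable u 0 t M) => // s _.
      by have /andP[u0 u1] := uM s; rewrite ger0_norm.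
    - by have [] := @int_leZ _ _ _ leb `[0, t] (measurable_itv _) _ _ _ S0
        (conj expi (lexx _)).
    - move=> s /=; rewrite in_itv /= => /andP[s1 s2]; apply: le_sup.
      by rewrite s1 (le_trans s2).
  move=> /(ler_wpM2l (ltW B0)) h; apply: le_trans (lerD (lexx K) h) _.
  have E1 : 1 <= expR (2 * B * t) by rewrite -[X in X <= _]expR0 ler_expR mulr_ge0// ltW.
  have -> : B * (sup A * ((expR (2 * B * t) - 1) / (2 * B))) =
    sup A / 2 * (expR (2 * B * t) - 1) by field; rewrite gt_eqF.
  move: (expR _) (sup A) E1 S0 => E S E1 S0'; nra.
apply: le_trans (le_sup t0 _) _; first by rewrite t00.
have S2 : sup A <= 2 * K by move: (sup A) step => S h; lra.
exact: ler_wpM2r (expR_ge0 _) _ _ S2.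
Qed.

End interval_integrals.

(** * Second moments of weak solutions *)

(** [measR2] carries the weak topology; this view presents the same point as a probability
    measure. *)
Definition path_law (R : realType) (mu : skorokhod R (measR2 R)) (s : R) :
  probability (R * R)%type R := mu s.

(** The partial derivative in x of (b x + a xi)^2. *)
Definition grad_sq (R : realType) (a b : R) : R * R -> R :=
  fun z => b * (2 * (b * z.1 + a * z.2)).

Section weak_solution_moments.
Variables (R : realType) (om tau V : R) (mu : skorokhod R (measR2 R)).
Hypotheses (om_gt0 : 0 < om) (tau_gt0 : 0 < tau).
Hypothesis mu_pde : weak_solution tau om mu.
Hypothesis init_x : forall e, 0 < e ->
  bracket (fun z => tsq e (1 * z.1 + 0 * z.2)) (mu 0) <= V.
Hypothesis init_xi : forall e, 0 < e ->
  bracket (fun z => tsq e (0 * z.1 + 1 * z.2)) (mu 0) <= V.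
Local Notation leb := (@lebesgue_measure R).
Implicit Types (a b e s t T : R) (p : R * R -> R).

Local Notation law := (path_law mu).

(** The derivative p is an argument, instead of a test function to be differentiated as in
    [drift_term]; p may then be the unbounded limit [grad_sq] as well as a truncated gradient. *)
Definition drift_along p s : R * R -> R :=
  fun z => drift tau om z.1 (lambda_of (mu s)) z.2 (cosine_of (mu s)) * p z.

Definition diffusion_along p s : R * R -> R :=
  fun z => diffusion tau om (cosine_of (mu s)) * p z.

Let drift_along_measurable p s : measurable_fun setT p ->
  measurable_fun setT (drift_along p s).
Proof. by move=> mp; rewrite /drift_along /drift; measurable_tac. Qed.

Let diffusion_along_measurable p s : measurable_fun setT p ->
  measurable_fun setT (diffusion_along p s).
Proof. by move=> mp; rewrite /diffusion_along; measurable_tac. Qed.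

(** Comparison with a constant avoids any claim that the inner integral is measurable in time. *)
Lemma bounded_abs_convergent (g : measR2 R -> R * R -> R) t K :
  (forall s, 0 <= s <= t -> (\int[law s]_z `|g (mu s) z|%:E <= K%:E)%E) ->
  abs_convergent g mu t.
Proof.
move=> gK; apply: (@le_lt_trans _ _ (\int[leb]_(s in `[0%R, t]) K%:E)%E).
  apply: ge0_le_integral_nomeas => s; rewrite /= in_itv /= => st.
    by apply: integral_ge0.
  exact: gK.
rewrite integral_cst//= lebesgue_measure_itv /= lte_fin.
by case: ifPn; rewrite ?mule0 ?ltry// oppr0 adde0 -EFinM ltry.
Qed.

Lemma pde_tsq a b e t K : 0 < e -> 0 <= t ->
  let p z := b * dtsq e (b * z.1 + a * z.2) in
  let q z := b * b * ddtsq e (b * z.1 + a * z.2) in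
  (forall s, 0 <= s <= t -> (\int[law s]_z `|drift_along p s z|%:E <= K%:E)%E) ->
  (forall s, 0 <= s <= t -> (\int[law s]_z `|diffusion_along q s z|%:E <= K%:E)%E) ->
  bracket (fun z => tsq e (b * z.1 + a * z.2)) (mu t) -
  bracket (fun z => tsq e (b * z.1 + a * z.2)) (mu 0) =
    \int[leb]_(s in `[0, t]) bracket (drift_along p s) (mu s) +
    2^-1 * \int[leb]_(s in `[0, t]) bracket (diffusion_along q s) (mu s).
Proof.
move=> e0 t0 p q pK qK; have e0' := ltW e0.
(* Adding 1 makes the test function strictly positive and cancels in the difference between times t
   and 0. The outer factor 1 matches the shape of the ridge lemmas. *)
pose f (z : R * R) := 1 * (1 + tsq e (b * z.1 + a * z.2)).
have d1 : derive1 (fun y => 1 + tsq e y) = dtsq e.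
  by apply/funext => y; rewrite derive1E; have [_ ->] := tsq_derive y e0'.
have d2 : derive1 (dtsq e) = ddtsq e.
  by apply/funext => y; rewrite derive1E; have [_ ->] := dtsq_derive y e0'.
have fx : d_x f = p.
  rewrite /f (@d_x_ridge R a b 1 (fun y => 1 + tsq e y)) ?d1.
    by apply/funext => z; rewrite mul1r.
  by move=> y; have [] := tsq_derive y e0'.
have fxx : d_x (d_x f) = q.
  rewrite fx /p (@d_x_ridge R a b b (dtsq e)) ?d2//.
  by move=> y; have [] := dtsq_derive y e0'.
have f0 z : 0 < f z by rewrite /f mul1r ltr_pwDl// tsq_ge0.
have fb : exists M, forall z, `|f z| <= M.
  exists (1 + e^-1) => z; rewrite gtr0_norm// /f mul1r lerD2l; exact: tsq_le_inv.
have fC : class_C 3 f.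
  exact: (@class_C_ridge R 3 a b 1 (fun y => 1 + tsq e y) (tsq_smooth1 3 e0')).
have br s : bracket f (mu s) = 1 + bracket (fun z => tsq e (b * z.1 + a * z.2)) (mu s).
  have ti := @tsq_integrable R a b (law s) e e0.
  have [ci c1] := @bound_cst R (law s) 1.
  have -> : f = fun z => 1 + tsq e (b * z.1 + a * z.2).
    by apply/funext => z; rewrite /f mul1r.
  rewrite /bracket.
  rewrite RintegralD//; congr (_ + _); rewrite Rintegral_cst//.
  rewrite [X in _ * X](_ : _ = 1) ?mulr1//.
  exact: (congr1 fine (probability_setT (law s))).
have := mu_pde f0 fb fC t0.
rewrite /drift_term /diffusion_term fxx fx !br.
move=> H; rewrite -[LHS](_ : 1 + bracket (fun z => tsq e (b * z.1 + a * z.2)) (mu t)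
  - (1 + bracket (fun z => tsq e (b * z.1 + a * z.2)) (mu 0)) = _); last by ring.
apply: H.
  exact: (@bounded_abs_convergent _ t K pK).
exact: (@bounded_abs_convergent _ t K qK).
Qed.

Lemma law_neg s : s < 0 -> law s = law 0.
Proof. by move=> s0; rewrite /path_law (@path_neg _ _ mu s s0). Qed.

(** With b = 0 the test function does not depend on x, so both terms on the right vanish and the
    truncated moment of xi is conserved. *)
Lemma xi_moment s : int_le (law s) setT (fun z => z.2 ^+ 2) V.
Proof.
wlog s0 : s / 0 <= s => [h|].
  by have [/h//|/law_neg ->] := leP 0 s; exact: h.
have E : (fun z : R * R => (0 * z.1 + 1 * z.2) ^+ 2) = (fun z => z.2 ^+ 2).
  by apply/funext => z; rewrite mul0r add0r mul1r.
rewrite -E; apply: tsq_fatou => n.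
have e0 : 0 < n.+1%:R^-1 :> R by rewrite invr_gt0.
have int0 k (h : R -> R * R -> R) : (forall s z, h s z = 0) ->
    (\int[law k]_z `|h k z|%:E)%E = 0%E.
  by move=> h0; under eq_integral do rewrite h0 normr0; rewrite integral0.
have br0 k (h : R -> R * R -> R) : (forall s z, h s z = 0) ->
    bracket (h k) (mu k) = 0.
  by move=> h0; rewrite /bracket /Rintegral; under eq_integral do rewrite h0;
    rewrite integral0.
have d0 p : (forall z, p z = 0) -> forall s z, drift_along p s z = 0.
  by move=> h k z; rewrite /drift_along h mulr0.
have f0 p : (forall z, p z = 0) -> forall s z, diffusion_along p s z = 0.
  by move=> h k z; rewrite /diffusion_along h mulr0.
have z1 (z : R * R) : 0 * dtsq n.+1%:R^-1 (0 * z.1 + 1 * z.2) = 0 by rewrite mul0r.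
have z2 (z : R * R) : 0 * 0 * ddtsq n.+1%:R^-1 (0 * z.1 + 1 * z.2) = 0.
  by rewrite !mul0r.
have le_of_eq (u v : \bar R) : u = v -> (u <= v)%E by move=> ->.
have := @pde_tsq 1 0 n.+1%:R^-1 s 0 e0 s0
  (fun k _ => le_of_eq _ _ (int0 k _ (d0 _ z1)))
  (fun k _ => le_of_eq _ _ (int0 k _ (f0 _ z2))).
rewrite (_ : (fun k => bracket (drift_along _ k) (mu k)) = fun=> 0); last first.
  by apply/funext => k; exact: br0 (d0 _ z1).
rewrite (_ : (fun k => bracket (diffusion_along _ k) (mu k)) = fun=> 0); last first.
  by apply/funext => k; exact: br0 (f0 _ z2).
rewrite !Rintegral_cst// !mul0r mulr0 addr0 => /eqP.
by rewrite subr_eq0 => /eqP ->; exact: init_xi.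
Qed.

Definition cosine_max := (1 + V) / 2.
Local Notation q := cosine_max.

Let V_ge0 : 0 <= V.
Proof.
by apply: le_trans (xi_moment 0).2; apply: Rintegral_ge0 => z _; exact: sqr_ge0.
Qed.

Let q_ge0 : 0 <= q.
Proof. by rewrite divr_ge0// addr_ge0. Qed.

Lemma cosine_le s : `|cosine_of (mu s)| <= q.
Proof. exact: (cosine_of_le (xi_moment s)). Qed.

Definition diffusion_max : R := tau ^+ 2 * (om * q ^+ 2 + 1).

Lemma diffusion_max_ge0 : 0 <= diffusion_max.
Proof.
by rewrite mulr_ge0 ?sqr_ge0// addr_ge0// mulr_ge0 ?sqr_ge0// ltW.
Qed.

Lemma diffusion_le s : 0 <= diffusion tau om (cosine_of (mu s)) <= diffusion_max.
Proof.
have Q0 := sqr_ge0 (cosine_of (mu s)).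
have oQ : 0 <= om * cosine_of (mu s) ^+ 2 by rewrite mulr_ge0// ltW.
apply/andP; split; first by rewrite mulr_ge0 ?sqr_ge0// addr_ge0.
rewrite ler_wpM2l ?sqr_ge0// lerD2r ler_pM2l//.
by rewrite -real_normK ?num_real// lerXn2r ?nnegrE ?cosine_le.
Qed.

Lemma diffusion_along_le p s K : 0 <= K -> measurable_fun setT p ->
  (forall z, `|p z| <= K) ->
  [/\ (law s).-integrable setT (EFin \o diffusion_along p s),
      `|bracket (diffusion_along p s) (mu s)| <= diffusion_max * K &
      (\int[law s]_z `|diffusion_along p s z|%:E <= (diffusion_max * K)%:E)%E].
Proof.
move=> K0 mp pK; have /andP[d0 dmax] := diffusion_le s.
apply: (@int_le_dominated _ _ _ (law s) setT measurableT _ (fun=> diffusion_max * K)).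
- by rewrite /diffusion_along; measurable_tac.
- by move=> z _; rewrite normrM (ger0_norm d0) ler_pM.
- exact: bound_cst.
Qed.

(** The point is that e is absent from the bound: the crude estimate 1 / e only provides the a
    priori finiteness that [gronwall] asks for and does not enter its conclusion. *)
Let truncated_growth e T : 0 < e -> 0 <= T -> forall t, 0 <= t <= T ->
  bracket (fun z => tsq e (1 * z.1 + 0 * z.2)) (mu t) <=
  2 * (V + tau * (om * q * V + 1) * T + 2^-1 * (diffusion_max * 6) * T) *
  expR (2 * (tau * (om * q + 3)) * t).
Proof.
move=> e0 T0; have e0' := ltW e0; have om0 := ltW om_gt0; have tau0 := ltW tau_gt0.
set A := tau * (om * q * V + 1); set D := diffusion_max * 6.
set B := tau * (om * q + 3).
have omq0 : 0 <= om * q by exact: mulr_ge0.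
have B0 : 0 < B by rewrite mulr_gt0// ltr_wpDl.
have A0 : 0 <= A by rewrite mulr_ge0// addr_ge0// mulr_ge0.
have D0 : 0 <= D by rewrite mulr_ge0// diffusion_max_ge0.
pose p (z : R * R) := 1 * dtsq e (1 * z.1 + 0 * z.2).
pose r (z : R * R) := 1 * 1 * ddtsq e (1 * z.1 + 0 * z.2).
have lE (z : R * R) : 1 * z.1 + 0 * z.2 = z.1 by rewrite mul1r mul0r addr0.
set U := fun s => bracket (fun z => tsq e (1 * z.1 + 0 * z.2)) (mu s).
have cts := tsq_continuous e0'.
have tsq_int s : int_le (law s) setT (fun z => tsq e (1 * z.1 + 0 * z.2)) (U s).
  by split=> //; exact: tsq_integrable.
have mp : measurable_fun setT p.
  apply: measurable_funM; first exact: measurable_cst.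
  exact: measurable_comp_linear (dtsq_continuous e0').
have mr : measurable_fun setT r.
  apply: measurable_funM; first exact: measurable_cst.
  exact: measurable_comp_linear (ddtsq_continuous e0').
have U_bnd s : 0 <= U s <= e^-1.
  apply/andP; split; first by apply: Rintegral_ge0 => z _; exact: tsq_ge0.
  apply: le_trans (bound_cst (law s) e^-1).2.
  apply: le_Rintegral => //; [exact: (tsq_int s).1|exact: (bound_cst _ _).1|].
  by move=> z _; exact: tsq_le_inv.
have mU : measurable_fun setT U.
  apply: measurable_bracket_bounded; first exact: continuous_comp_linear.
  by exists e^-1 => z; rewrite ger0_norm ?tsq_le_inv// tsq_ge0.
have p2 s : int_le (law s) setT (fun z => p z ^+ 2 / 4) (U s).
  apply: int_le_mono (tsq_int s) => //; first by measurable_tac.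
  move=> z _; apply/andP; split; first by rewrite divr_ge0// sqr_ge0.
  by rewrite /p mul1r dtsq_sqr_le.
have xp s : int_le (law s) setT (fun z => `|z.1 * p z|) (2 * U s).
  apply: int_le_mono (int_leZ _ _ (tsq_int s)) => //.
    by apply: measurableT_comp => //; measurable_tac.
  move=> z _; apply/andP; split; first exact: normr_ge0.
  by rewrite /p mul1r lE mul_dtsq_le.
have drift_le s := drift_bound tau0 om0 mp (xi_moment s) (p2 s) (xp s).
(* The 3 in B is 1 from the singular term x / lambda plus 2 from the bound on |x p|. *)
have drift_leU s : tau * (om * q * (V + U s) + (1 + U s) + 2 * U s) = A + B * U s.
  by rewrite /A /B; ring.
have r6 z : `|r z| <= 6 by rewrite /r !mul1r; exact: ddtsq_le.
have diff_le s := diffusion_along_le s (ler0n _ 6) mr r6.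
apply: (@gronwall _ U (V + A * T + 2^-1 * D * T) B T e^-1) => //.
  have h1 : 0 <= A * T by exact: mulr_ge0.
  have h2 : 0 <= 2^-1 * D * T by apply: mulr_ge0 => //; exact: mulr_ge0.
  by rewrite addr_ge0// addr_ge0.
move=> t /andP[t0 tT].
(* [pde_tsq] takes one constant for both terms, so the drift and diffusion bounds are added. *)
have abs1 s : 0 <= s <= t ->
    (\int[law s]_z `|drift_along p s z|%:E <= (A + B * e^-1 + D)%:E)%E.
  move=> _; have [_ _ /le_trans] := drift_le s; apply.
  rewrite lee_fin -/q drift_leU ler_wpDr// lerD2l ler_wpM2l ?(ltW B0)//.
  by have /andP[] := U_bnd s.
have abs2 s : 0 <= s <= t ->
    (\int[law s]_z `|diffusion_along r s z|%:E <= (A + B * e^-1 + D)%:E)%E.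
  move=> _; have [_ _ /le_trans] := diff_le s; apply.
  by rewrite lee_fin ler_wpDl// addr_ge0// mulr_ge0 ?(ltW B0)// invr_ge0.
have := pde_tsq e0 t0 abs1 abs2; rewrite -/(U t) -/(U 0) -/p -/r => /eqP.
rewrite subr_eq => /eqP ->.
have ABi : int_le leb `[0, t] (fun s => A + B * U s)
    (A * t + B * \int[leb]_(s in `[0, t]) U s).
  apply: int_leD => //.
    split; last by rewrite Rintegral_itv_cst// subr0.
    apply: (@bounded_itv_integrable _ (fun=> A) _ _ A); first exact: measurable_cst.
    by move=> *; rewrite ger0_norm.
  apply: int_leZ => //; first exact: ltW.
  split=> //; apply: (@bounded_itv_integrable _ U _ _ e^-1) => // s _.
  by have /andP[u0 u1] := U_bnd s; rewrite ger0_norm.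
have I1 : \int[leb]_(s in `[0, t]) bracket (drift_along p s) (mu s) <=
    A * t + B * \int[leb]_(s in `[0, t]) U s.
  apply: le_trans ABi.2; apply: le_Rintegral_nomeas => //; first exact: ABi.1.
    move=> s _; have /andP[U0 _] := U_bnd s.
    by rewrite addr_ge0// mulr_ge0// ltW.
  move=> s _; have [_ + _] := drift_le s; rewrite -/q drift_leU.
  by apply: le_trans; rewrite ler_norm.
have I2 : \int[leb]_(s in `[0, t]) bracket (diffusion_along r s) (mu s) <= D * t.
  rewrite -[t in leRHS]subr0 -Rintegral_itv_cst//; apply: le_Rintegral_nomeas => //.
    apply: (@bounded_itv_integrable _ (fun=> D) _ _ D); first exact: measurable_cst.
    by move=> *; rewrite ger0_norm.
  move=> s _; have [_ + _] := diff_le s; apply: le_trans; exact: ler_norm.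
have U0 : U 0 <= V by exact: init_x.
have : A * t <= A * T by rewrite ler_wpM2l.
have : D * t <= D * T by rewrite ler_wpM2l.
move: (Rintegral _ _ _) (Rintegral _ _ _) (Rintegral _ _ _) I1 I2 => i1 i2 i3 I1 I2.
by move=> h1 h2; rewrite -mulrA; lra.
Qed.

Lemma x_moment T : exists B, forall s, s <= T ->
  int_le (law s) setT (fun z => z.1 ^+ 2) B.
Proof.
wlog T0 : T / 0 <= T => [h|].
  have [/h//|T0] := leP 0 T; have [B hB] := h 0 (lexx _).
  by exists B => s sT; apply: hB; rewrite (le_trans sT)// ltW.
have om0 := ltW om_gt0; have tau0 := ltW tau_gt0.
set C := V + tau * (om * q * V + 1) * T + 2^-1 * (diffusion_max * 6) * T.
set k := 2 * (tau * (om * q + 3)).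
have k0 : 0 <= k.
  by apply: mulr_ge0 => //; apply: mulr_ge0 => //; apply: addr_ge0 => //; exact: mulr_ge0.
have C0 : 0 <= C.
  rewrite addr_ge0//; last first.
    apply: mulr_ge0 => //; apply: mulr_ge0 => //; apply: mulr_ge0 => //.
    exact: diffusion_max_ge0.
  rewrite addr_ge0// mulr_ge0// mulr_ge0// addr_ge0//.
  by rewrite mulr_ge0// mulr_ge0.
have E : (fun z : R * R => (1 * z.1 + 0 * z.2) ^+ 2) = (fun z => z.1 ^+ 2).
  by apply/funext => z; rewrite mul0r addr0 mul1r.
have bnd s : 0 <= s <= T ->
    int_le (law s) setT (fun z => z.1 ^+ 2) (2 * C * expR (k * T)).
  move=> sT; rewrite -E; apply: tsq_fatou => n.
  have e0 : 0 < n.+1%:R^-1 :> R by rewrite invr_gt0.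
  apply: le_trans (truncated_growth e0 T0 sT) _.
  rewrite -/C -/k ler_wpM2l ?mulr_ge0// ler_expR ler_wpM2l//.
  by have /andP[] := sT.
exists (2 * C * expR (k * T)) => s sT; have [s0|s0] := leP 0 s.
  by apply: bnd; rewrite s0.
by rewrite (law_neg s0); apply: bnd; rewrite lexx.
Qed.


Lemma measurable_lambda : measurable_fun setT (fun s => lambda_of (mu s)).
Proof.
have ms := continuous_measurable_fun (@sqrt_continuous R).
suff mx : measurable_fun setT (fun s => bracket (fun z => z.1 ^+ 2) (mu s)).
  exact: (measurableT_comp ms mx).
apply: measurable_bracket.
- by move=> z; apply: cvgM; exact: cvg_fst.
- by measurable_tac.
- by move=> s; have [B h] := x_moment s; exact: (h s (lexx _)).1.
Qed.

Lemma measurable_invf_lambda : measurable_fun setT (fun s => (lambda_of (mu s))^-1).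
Proof.
rewrite (_ : (fun _ => _) = fun s => lambda_of (mu s) `^ (-1)).
  exact: (measurableT_comp (measurable_powR (-1)) measurable_lambda).
by apply/funext => s; rewrite powR_inv1// sqrtr_ge0.
Qed.

Lemma pair_integrable p s u : measurable_fun setT p ->
  int_le (law s) setT (fun z => p z ^+ 2 / 4) u ->
  [/\ (law s).-integrable setT (EFin \o p),
      (law s).-integrable setT (EFin \o (fun z => z.1 * p z)) &
      (law s).-integrable setT (EFin \o (fun z => z.2 * p z))].
Proof.
move=> mp pu; have [B /(_ s (lexx _)) xB] := x_moment s; split.
- have [] // := @int_le_dominated _ _ _ (law s) setT measurableT p
    (fun z => 1 + p z ^+ 2 / 4) (1 + u) mp.
  + by move=> z _; have := normM_le_sqr4 1 (p z); rewrite mul1r expr1n.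
  + by apply: int_leD => //; exact: bound_cst.
- have [] // := @int_le_dominated _ _ _ (law s) setT measurableT
    (fun z => z.1 * p z) (fun z => z.1 ^+ 2 + p z ^+ 2 / 4) (B + u).
  + by measurable_tac.
  + by move=> z _; exact: normM_le_sqr4.
  + exact: int_leD.
- have [] // := @int_le_dominated _ _ _ (law s) setT measurableT
    (fun z => z.2 * p z) (fun z => z.2 ^+ 2 + p z ^+ 2 / 4) (V + u).
  + by measurable_tac.
  + by move=> z _; exact: normM_le_sqr4.
  + by apply: int_leD => //; exact: xi_moment.
Qed.

Lemma cross_integrable s :
  (law s).-integrable setT (EFin \o (fun z : R * R => z.1 * z.2)).
Proof.
have [] // := @pair_integrable snd s (4^-1 * V).
apply: int_le_mono (int_leZ _ _ (xi_moment s)) => //.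
- by measurable_tac.
- by move=> z _; rewrite [_ / 4]mulrC lexx andbT mulr_ge0 ?invr_ge0 ?sqr_ge0.
Qed.

Lemma measurable_cosine : measurable_fun setT (fun s => cosine_of (mu s)).
Proof.
apply: measurable_funM measurable_invf_lambda.
apply: measurable_bracket; last exact: cross_integrable.
- by move=> z; apply: cvgM; [exact: cvg_fst|exact: cvg_snd].
- by measurable_tac.
Qed.

Lemma measurable_drift_along p : continuous p -> measurable_fun setT p ->
  (forall s, exists u, int_le (law s) setT (fun z => p z ^+ 2 / 4) u) ->
  measurable_fun setT (fun s => bracket (drift_along p s) (mu s)).
Proof.
move=> cp mp pu.
have pI s : [/\ (law s).-integrable setT (EFin \o p),
      (law s).-integrable setT (EFin \o (fun z => z.1 * p z)) &
      (law s).-integrable setT (EFin \o (fun z => z.2 * p z))].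
  by have [u] := pu s; exact: pair_integrable.
rewrite (_ : (fun _ => _) = fun s => tau * (om * cosine_of (mu s) *
    bracket (fun z => z.2 * p z) (mu s) +
    (lambda_of (mu s))^-1 * bracket (fun z => z.1 * p z) (mu s) -
    bracket (fun z => z.1 * p z) (mu s))); last first.
  by apply/funext => s; have [] := pI s; exact: bracket_drift.
have mx : measurable_fun setT (fun s => bracket (fun z => z.1 * p z) (mu s)).
  apply: measurable_bracket; last by move=> s; have [] := pI s.
    by move=> z; apply: cvgM; [exact: cvg_fst|exact: cp].
  by measurable_tac.
have mxi : measurable_fun setT (fun s => bracket (fun z => z.2 * p z) (mu s)).
  apply: measurable_bracket; last by move=> s; have [] := pI s.
    by move=> z; apply: cvgM; [exact: cvg_snd|exact: cp].
  by measurable_tac.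
have mQ := measurable_cosine; have ml := measurable_invf_lambda.
by measurable_tac.
Qed.

Lemma linear_moment a b T : `|a| <= 1 -> `|b| <= 1 ->
  exists L, forall s, s <= T -> int_le (law s) setT (fun z => (b * z.1 + a * z.2) ^+ 2) L.
Proof.
move=> a1 b1; have [B hB] := x_moment T; exists (2 * B + 2 * V) => s sT.
apply: int_le_mono (int_leD measurableT (int_leZ measurableT (ler0n _ 2) (hB s sT))
  (int_leZ measurableT (ler0n _ 2) (xi_moment s))) => //.
  by measurable_tac.
move=> [x y] _ /=; rewrite sqr_ge0 /=.
have ha : (a * y) ^+ 2 <= y ^+ 2.
  by rewrite exprMn ler_piMl ?sqr_ge0// -real_normK ?num_real// expr_le1.
have hb : (b * x) ^+ 2 <= x ^+ 2.
  by rewrite exprMn ler_piMl ?sqr_ge0// -real_normK ?num_real// expr_le1.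
by have := sqr_ge0 (b * x - a * y); rewrite sqrrB sqrrD; lra.
Qed.

Lemma grad_sq_measurable a b : measurable_fun setT (grad_sq a b).
Proof. by rewrite /grad_sq; measurable_tac. Qed.

Lemma grad_sq_continuous a b : continuous (grad_sq a b).
Proof.
move=> z; apply: cvgM; first exact: cvg_cst.
by apply: cvgM; [exact: cvg_cst|exact: linear_continuous2].
Qed.

Lemma grad_sq_moment a b T : `|a| <= 1 -> `|b| <= 1 ->
  exists L, forall s, s <= T -> int_le (law s) setT (fun z => grad_sq a b z ^+ 2 / 4) L.
Proof.
move=> a1 b1; have [L hL] := linear_moment T a1 b1; exists L => s sT.
apply: int_le_mono (hL s sT) => //; first by measurable_tac.
move=> z _; rewrite divr_ge0 ?sqr_ge0//= /grad_sq; move: (_ + _) => l.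
have -> : (b * (2 * l)) ^+ 2 / 4 = b ^+ 2 * l ^+ 2 by field.
by rewrite ler_piMl ?sqr_ge0// -real_normK ?num_real// expr_le1.
Qed.

Lemma drift_grad_sq_bound a b T : `|a| <= 1 -> `|b| <= 1 ->
  exists K, forall s, s <= T ->
  [/\ (law s).-integrable setT (EFin \o drift_along (grad_sq a b) s),
      `|bracket (drift_along (grad_sq a b) s) (mu s)| <= K &
      (\int[law s]_z `|drift_along (grad_sq a b) s z|%:E <= K%:E)%E].
Proof.
move=> a1 b1; have [L hL] := grad_sq_moment T a1 b1; have [B hB] := x_moment T.
eexists => s sT; apply: (drift_bound (ltW tau_gt0) (ltW om_gt0) (@grad_sq_measurable a b)
  (xi_moment s) (hL s sT)).
apply: int_le_mono (int_leD measurableT (hB s sT) (hL s sT)) => //.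
  by apply: measurableT_comp => //; measurable_tac.
by move=> z _; rewrite normr_ge0 normM_le_sqr4.
Qed.

Lemma measurable_diffusion_along p K : measurable_fun setT p ->
  continuous p -> (forall z, `|p z| <= K) ->
  measurable_fun setT (fun s => bracket (diffusion_along p s) (mu s)).
Proof.
move=> mp cp pK; rewrite (_ : (fun _ => _) = fun s =>
    diffusion tau om (cosine_of (mu s)) * bracket p (mu s)); last first.
  apply/funext => s; rewrite /bracket /diffusion_along RintegralZl//.
  have [] // := @int_le_dominated _ _ _ (law s) setT measurableT p (fun=> K) K mp
    (fun z _ => pK z) (bound_cst (law s) K).
have mb : measurable_fun setT (fun s => bracket p (mu s)).
  by apply: measurable_bracket_bounded => //; exists K.
by have mQ := measurable_cosine; rewrite /diffusion; measurable_tac.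
Qed.

(** Dominated convergence is applied at two levels: under the law at each fixed time, then in time,
    where the brackets are bounded by constants on [0, t]. *)
Lemma moment_identity a b t : `|a| <= 1 -> `|b| <= 1 -> 0 <= t ->
  bracket (fun z => (b * z.1 + a * z.2) ^+ 2) (mu t) -
  bracket (fun z => (b * z.1 + a * z.2) ^+ 2) (mu 0) =
    \int[leb]_(s in `[0, t]) bracket (drift_along (grad_sq a b) s) (mu s) +
    2^-1 * \int[leb]_(s in `[0, t])
      bracket (diffusion_along (fun=> b * b * 2) s) (mu s).
Proof.
move=> a1 b1 t0; pose e n : R := n.+1%:R^-1.
have e0 n : 0 < e n by rewrite invr_gt0.
have e0' n := ltW (e0 n).
pose p n (z : R * R) := b * dtsq (e n) (b * z.1 + a * z.2).
pose r n (z : R * R) := b * b * ddtsq (e n) (b * z.1 + a * z.2).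
have bb1 : `|b * b| <= 1 by rewrite normrM -[leRHS]mul1r ler_pM.
have mp n : measurable_fun setT (p n).
  apply: measurable_funM; first exact: measurable_cst.
  exact: measurable_comp_linear (dtsq_continuous (e0' n)).
have cp n : continuous (p n).
  move=> z; apply: cvgM; first exact: cvg_cst.
  exact: continuous_comp_linear (dtsq_continuous (e0' n)) z.
have mr n : measurable_fun setT (r n).
  apply: measurable_funM; first exact: measurable_cst.
  exact: measurable_comp_linear (ddtsq_continuous (e0' n)).
have cr n : continuous (r n).
  move=> z; apply: cvgM; first exact: cvg_cst.
  exact: continuous_comp_linear (ddtsq_continuous (e0' n)) z.
have p_le n z : `|p n z| <= `|grad_sq a b z|.
  rewrite /p /grad_sq normrM [leRHS]normrM ler_wpM2l// [leRHS]normrM.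
  by rewrite (ger0_norm (ler0n R 2)) dtsq_le.
have r_le n z : `|r n z| <= 6.
  by rewrite /r normrM -[leRHS]mul1r ler_pM//; exact: ddtsq_le.
(* Since |dtsq e y| <= 2 |y|, the limiting integrand itself dominates all the truncated ones. *)
have drift_p_le n s z : `|drift_along (p n) s z| <= `|drift_along (grad_sq a b) s z|.
  by rewrite /drift_along normrM [leRHS]normrM ler_wpM2l.
have [K hK] := drift_grad_sq_bound t a1 b1.
have hp n s : s <= t -> [/\ (law s).-integrable setT (EFin \o drift_along (p n) s),
      `|bracket (drift_along (p n) s) (mu s)| <= K &
      (\int[law s]_z `|drift_along (p n) s z|%:E <= K%:E)%E].
  move=> st; have [di _ dK] := hK s st.
  apply: (@int_le_dominated _ _ _ (law s) setT measurableT _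
    (fun z => `|drift_along (grad_sq a b) s z|)) => //.
    exact: drift_along_measurable.
  split; first exact: integrable_norm.
  rewrite -lee_fin fineK//.
  by have := integrable_fin_num measurableT (integrable_norm di).
have hr n s := diffusion_along_le s (ler0n _ 6) (mr n) (r_le n).
have D0 : 0 <= diffusion_max * 6 by rewrite mulr_ge0// diffusion_max_ge0.
have K0 : 0 <= K by have [_ + _] := hp 0%N t (lexx _); exact: le_trans.
have pde n := @pde_tsq a b (e n) t (K + diffusion_max * 6) (e0 n) t0
  ltac:(by move=> s /andP[_ st]; have [_ _ /le_trans] := hp n s st; apply;
        rewrite lee_fin lerDl)
  ltac:(by move=> s _; have [_ _ /le_trans] := hr n s; apply;
        rewrite lee_fin lerDr).
have lhs s : bracket (fun z => tsq (e n) (b * z.1 + a * z.2)) (mu s)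
    @[n --> \oo] --> bracket (fun z => (b * z.1 + a * z.2) ^+ 2) (mu s).
  have [L /(_ s (lexx _))[Li _]] := linear_moment s a1 b1.
  apply: (@Rintegral_cvg _ _ _ (law s) setT measurableT _ _
    (fun z => (b * z.1 + a * z.2) ^+ 2)) => //.
  - by move=> n; exact: measurable_comp_linear (tsq_continuous (e0' n)).
  - by measurable_tac.
  - by move=> z _; exact: cvg_tsq.
  - by move=> n z _; rewrite ger0_norm ?tsq_ge0// tsq_le_sqr.
have drift_cvg s : s <= t -> bracket (drift_along (p n) s) (mu s)
    @[n --> \oo] --> bracket (drift_along (grad_sq a b) s) (mu s).
  move=> st; have [di _ _] := hK s st.
  apply: (@Rintegral_cvg _ _ _ (law s) setT measurableT _ _
    (fun z => `|drift_along (grad_sq a b) s z|)) => //.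
  - by move=> n; exact: drift_along_measurable.
  - by apply: drift_along_measurable; exact: grad_sq_measurable.
  - move=> z _; apply: cvgM; first exact: cvg_cst.
    by apply: cvgM; [exact: cvg_cst|exact: cvg_dtsq].
  - exact: integrable_norm.
have diff_cvg s : bracket (diffusion_along (r n) s) (mu s)
    @[n --> \oo] --> bracket (diffusion_along (fun=> b * b * 2) s) (mu s).
  apply: (@Rintegral_cvg _ _ _ (law s) setT measurableT _ _
    (fun z => diffusion_max * 6)) => //.
  - by move=> n; exact: diffusion_along_measurable.
  - by apply: diffusion_along_measurable; exact: measurable_cst.
  - by move=> z _; apply: cvgM; [exact: cvg_cst|
      apply: cvgM; [exact: cvg_cst|exact: cvg_ddtsq]].
  - exact: (bound_cst _ _).1.
  - move=> n z _; have /andP[d0 d1] := diffusion_le s.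
    by rewrite normrM (ger0_norm d0) ler_pM.
have cst_int k : 0 <= k -> leb.-integrable `[0, t] (EFin \o (fun=> k)).
  move=> k0; apply: (@bounded_itv_integrable _ (fun=> k) 0 t k).
    exact: measurable_cst.
  by move=> *; rewrite ger0_norm.
have rhs1 : \int[leb]_(s in `[0, t]) bracket (drift_along (p n) s) (mu s)
    @[n --> \oo] -->
    \int[leb]_(s in `[0, t]) bracket (drift_along (grad_sq a b) s) (mu s).
  apply: (@Rintegral_cvg _ _ _ leb `[0, t] _ _ _ (fun=> K)) => //.
  - move=> n; apply: measurable_funTS; apply: (measurable_drift_along (cp n) (mp n)) => s.
    have [L hL] := grad_sq_moment s a1 b1; exists L.
    apply: int_le_mono (hL s (lexx _)) => //; first by have mpn := mp n; measurable_tac.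
    move=> z _; rewrite divr_ge0 ?sqr_ge0//= ler_pM2r ?invr_gt0//.
    rewrite -[leLHS]real_normK ?num_real// -[leRHS]real_normK ?num_real//.
    by rewrite lerXn2r ?nnegrE.
  - apply: measurable_funTS.
    apply: (measurable_drift_along (@grad_sq_continuous a b)
      (@grad_sq_measurable a b)) => s.
    by have [L hL] := grad_sq_moment s a1 b1; exists L; exact: hL.
  - by move=> s /=; rewrite in_itv /= => /andP[_ st]; exact: drift_cvg.
  - exact: cst_int.
  - move=> n s /=; rewrite in_itv /= => /andP[_ st].
    by have [] := hp n s st.
have rhs2 : \int[leb]_(s in `[0, t]) bracket (diffusion_along (r n) s) (mu s)
    @[n --> \oo] --> \int[leb]_(s in `[0, t])
      bracket (diffusion_along (fun=> b * b * 2) s) (mu s).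
  apply: (@Rintegral_cvg _ _ _ leb `[0, t] _ _ _ (fun=> diffusion_max * 6)) => //.
  - move=> n; apply: measurable_funTS.
    exact: measurable_diffusion_along (mr n) (cr n) (r_le n).
  - apply: measurable_funTS; apply: (@measurable_diffusion_along _ `|b * b * 2|) => //.
    by move=> z; exact: cvg_cst.
  - exact: cst_int.
  - by move=> n s _; have [] := hr n s.
pose rhs n := \int[leb]_(s in `[0, t]) bracket (drift_along (p n) s) (mu s) +
  2^-1 * \int[leb]_(s in `[0, t]) bracket (diffusion_along (r n) s) (mu s).
have rhs_cvg : rhs n @[n --> \oo] -->
    \int[leb]_(s in `[0, t]) bracket (drift_along (grad_sq a b) s) (mu s) +
    2^-1 * \int[leb]_(s in `[0, t])
      bracket (diffusion_along (fun=> b * b * 2) s) (mu s).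
  by apply: cvgD => //; apply: cvgM => //; exact: cvg_cst.
apply: (cvg_unique _ _ rhs_cvg) => //.
rewrite (_ : rhs = fun n =>
  bracket (fun z => tsq (e n) (b * z.1 + a * z.2)) (mu t) -
  bracket (fun z => tsq (e n) (b * z.1 + a * z.2)) (mu 0)).
  by apply: cvgB.
by apply/funext => n; rewrite pde.
Qed.

End weak_solution_moments.

(** * Regularity of primitives on the half-line *)

Section primitives.
Variable R : realType.
Local Notation leb := (@lebesgue_measure R).
Implicit Types (h Y : R -> R) (s t T K : R).

Lemma Rintegral_itv_split h (a b c : R) K : measurable_fun setT h ->
  a <= b -> b <= c -> (forall s, a <= s <= c -> `|h s| <= K) ->
  \int[leb]_(s in `[a, c]) h s - \int[leb]_(s in `[a, b]) h s =
  \int[leb]_(s in `[b, c]) h s.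
Proof.
move=> mh ab bc hK; have hi := bounded_itv_integrable mh hK.
rewrite Rintegral_itvB ?bnd_simp//.
rewrite Rintegral_itv_obnd_cbnd//; apply: integrableS hi => //.
by (move=> x; rewrite /= !in_itv /= => /andP[bx ->];
  rewrite (le_trans ab (ltW bx))).
Qed.

(** The primitive of a locally bounded function is locally Lipschitz. Continuity of h cannot be
    assumed: the rate involves Q, whose continuity is deduced from this very lemma. *)
Lemma primitive_continuous h Y : measurable_fun setT h ->
  (forall T, exists K, forall s, 0 <= s <= T -> `|h s| <= K) ->
  (forall t, 0 <= t -> Y t - Y 0 = \int[leb]_(s in `[0, t]) h s) ->
  (forall t, t < 0 -> Y t = Y 0) -> continuous Y.
Proof.
(* The horizon |x| + 1 contains the ball of radius 1 around x. *)
move=> mh hb hY Y0 x; have [K hK] := hb (`|x| + 1).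
have Ymax t : Y t = Y (Num.max 0 t).
  by have [//|t0] := leP 0 t; exact: Y0.
have lip s t : 0 <= s -> s <= t -> t <= `|x| + 1 -> `|Y t - Y s| <= K * (t - s).
  move=> s0 st tx; have t0 := le_trans s0 st.
  have -> : Y t - Y s = (Y t - Y 0) - (Y s - Y 0) by ring.
  have hKt u : 0 <= u <= t -> `|h u| <= K.
    by move=> /andP[u0 ut]; apply: hK; rewrite u0 (le_trans ut).
  rewrite !hY// (Rintegral_itv_split mh s0 st hKt); apply: Rintegral_itv_le => //.
  by move=> u /andP[su ut]; apply: hKt; rewrite (le_trans s0).
have K0 : 0 <= K by apply: le_trans (hK 0 _); rewrite // lexx addr_ge0.
have lip2 s t : s <= t -> t <= `|x| + 1 -> `|Y t - Y s| <= K * (t - s).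
  move=> st tx; rewrite (Ymax s) (Ymax t).
  apply: le_trans (lip (Num.max 0 s) (Num.max 0 t) _ _ _) _.
  - by rewrite le_max lexx.
  - by rewrite ge_max !le_max lexx st orbT.
  - by rewrite ge_max tx addr_ge0.
  rewrite ler_wpM2l//; have [s0|s0] := leP 0 s; have [t0|t0] := leP 0 t => //.
  + by have := le_trans s0 st; rewrite leNgt t0.
  + by rewrite lerD2l lerN2 ltW.
  + by rewrite subrr subr_ge0.
have lip3 s t : s <= `|x| + 1 -> t <= `|x| + 1 -> `|Y t - Y s| <= K * `|t - s|.
  move=> sx tx; have [st|/ltW ts] := leP s t.
    by rewrite [`|t - s|]ger0_norm ?subr_ge0//; exact: lip2.
  by rewrite distrC [`|t - s|]distrC [`|s - t|]ger0_norm ?subr_ge0//; exact: lip2.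
apply/cvgrPdist_lt => e e0.
(* K may be 0, hence the division by K + 1. *)
have e1 : 0 < Num.min 1 (e / (K + 1)).
  by rewrite lt_min ltr01 divr_gt0// ltr_wpDl.
near=> y.
have yx : `|x - y| < Num.min 1 (e / (K + 1)).
  by near: y; apply/nbhs_ballP; exists (Num.min 1 (e / (K + 1))).
move: yx; rewrite lt_min => /andP[y1 y2].
have xx : x <= `|x| + 1 by rewrite ler_wpDr// ler_norm.
have yx : y <= `|x| + 1.
  have -> : y = x - (x - y) by ring.
  apply: lerD; first exact: ler_norm.
  by apply: le_trans (ler_norm _) _; rewrite normrN ltW.
apply: le_lt_trans (lip3 _ _ yx xx) _.
have K1 : 0 < K + 1 by rewrite ltr_wpDl.
apply: (@le_lt_trans _ _ ((K + 1) * `|x - y|)).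
  by rewrite ler_wpM2r// lerDl.
by rewrite mulrC -ltr_pdivlMr.
Unshelve. all: by end_near. Qed.

(** Y may have a corner at 0, as a path frozen at negative times does. Starting the integral at -1
    gives a function that agrees with Y on [0, +oo[ and is differentiable on both sides of 0. *)
Lemma primitive_derive h Y : continuous h ->
  (forall t, 0 <= t -> Y t - Y 0 = \int[leb]_(s in `[0, t]) h s) ->
  exists2 F : R -> R, (forall t, 0 <= t -> F t = Y t) &
    forall t, 0 <= t -> is_derive t 1 F (h t).
Proof.
move=> ch hY; have mh := continuous_measurable_fun ch.
have hi a b : leb.-integrable `[a, b] (EFin \o h).
  apply: continuous_compact_integrable; first exact: segment_compact.
  exact: continuous_subspaceT.
exists (fun t => Y 0 - \int[leb]_(s in `[-1, 0]) h s + \int[leb]_(s in `[-1, t]) h s).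
  move=> t t0; have : Y t - Y 0 = \int[leb]_(s in `[-1, t]) h s -
      \int[leb]_(s in `[-1, 0]) h s; last by move=> E; lra.
  rewrite hY// Rintegral_itvB ?bnd_simp//.
  rewrite Rintegral_itv_obnd_cbnd//; apply: integrableS (hi (-1) t) => //.
  move=> x; rewrite /= !in_itv /= => /andP[x0 ->]; rewrite andbT ltW//.
  by rewrite (lt_trans _ x0)// ltrN10.
move=> t t0; have tt : t < t + 1 by rewrite ltrDl.
have a1 : -1 < t by rewrite (lt_le_trans _ t0)// ltrN10.
have [dF F'] := continuous_FTC1_closed tt (hi (-1) (t + 1)) a1 (ch t).
have dG : is_derive t 1 (fun t => \int[leb]_(s in `[-1, t]) h s) (h t).
  by apply: DeriveDef => //; rewrite -derive1E.
have dC := is_derive_cst (Y 0 - \int[leb]_(s in `[-1, 0]) h s) t (1 : R).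
by apply: trigger_derive (is_deriveD dC dG) _; rewrite add0r.
Qed.

End primitives.

(** * The differential equation for lambda *)

Section lambda_ode.
Variables (R : realType) (om tau V : R) (mu : skorokhod R (measR2 R)).
Hypotheses (om_gt0 : 0 < om) (tau_gt0 : 0 < tau).
Hypothesis mu_pde : weak_solution tau om mu.
Hypothesis init_x : forall e, 0 < e ->
  bracket (fun z => tsq e (1 * z.1 + 0 * z.2)) (mu 0) <= V.
Hypothesis init_xi : forall e, 0 < e ->
  bracket (fun z => tsq e (0 * z.1 + 1 * z.2)) (mu 0) <= V.
Local Notation leb := (@lebesgue_measure R).
Local Notation law := (path_law mu).
Implicit Types (a b s t : R).

Let lam s := lambda_of (mu s).
Let Q s := cosine_of (mu s).
Let moment a b s := bracket (fun z => (b * z.1 + a * z.2) ^+ 2) (mu s).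

Let x_int s : (law s).-integrable setT (EFin \o (fun z : R * R => z.1 ^+ 2)).
Proof.
by have [B hB] := x_moment om_gt0 tau_gt0 mu_pde init_x init_xi s;
  exact: (hB s (lexx _)).1.
Qed.

Let moment_rate a b s := bracket (drift_along om tau mu (grad_sq a b) s) (mu s) +
  2^-1 * bracket (diffusion_along om tau mu (fun=> b * b * 2) s) (mu s).

Let drift_measurable a b : `|a| <= 1 -> `|b| <= 1 -> measurable_fun setT
  (fun s => bracket (drift_along om tau mu (grad_sq a b) s) (mu s)).
Proof.
move=> a1 b1; apply: (measurable_drift_along om_gt0 tau_gt0 mu_pde init_x init_xi).
- exact: grad_sq_continuous.
- exact: grad_sq_measurable.
- move=> s; have [L hL] := grad_sq_moment om_gt0 tau_gt0 mu_pde init_x init_xi s a1 b1.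
  by exists L; exact: hL.
Qed.

Let diffusion_measurable b : measurable_fun setT
  (fun s => bracket (diffusion_along om tau mu (fun=> b * b * 2) s) (mu s)).
Proof.
apply: (measurable_diffusion_along om_gt0 tau_gt0 mu_pde init_x init_xi
  (K := `|b * b * 2|)) => //.
by move=> z; exact: cvg_cst.
Qed.

Let moment_rate_measurable a b : `|a| <= 1 -> `|b| <= 1 ->
  measurable_fun setT (moment_rate a b).
Proof.
move=> a1 b1; apply: measurable_funD; first exact: drift_measurable.
apply: measurable_funM; first exact: measurable_cst.
exact: diffusion_measurable.
Qed.

Let drift_bounded a b T : `|a| <= 1 -> `|b| <= 1 -> exists K, forall s, s <= T ->
  `|bracket (drift_along om tau mu (grad_sq a b) s) (mu s)| <= K.
Proof.
move=> a1 b1.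
have [K hK] := drift_grad_sq_bound om_gt0 tau_gt0 mu_pde init_x init_xi T a1 b1.
by exists K => s /hK[].
Qed.

Let diffusion_bounded b : exists K, forall s,
  `|bracket (diffusion_along om tau mu (fun=> b * b * 2) s) (mu s)| <= K.
Proof.
exists (diffusion_max om tau V * `|b * b * 2|) => s.
have pb (z : R * R) : `|b * b * 2| <= `|b * b * 2| by [].
by have [] := diffusion_along_le om_gt0 mu_pde init_xi s (normr_ge0 (b * b * 2))
  (measurable_cst (b * b * 2)) pb.
Qed.

Let moment_rate_bounded a b T : `|a| <= 1 -> `|b| <= 1 ->
  exists K, forall s, 0 <= s <= T ->
  `|moment_rate a b s| <= K.
Proof.
move=> a1 b1; have [K hK] := drift_bounded T a1 b1.
have [D hD] := diffusion_bounded b.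
exists (K + 2^-1 * D) => s /andP[_ sT]; apply: le_trans (ler_normD _ _) _.
by rewrite lerD ?hK// normrM ger0_norm ?invr_ge0// ler_wpM2l ?invr_ge0.
Qed.

Let moment_integral a b t : `|a| <= 1 -> `|b| <= 1 -> 0 <= t ->
  moment a b t - moment a b 0 = \int[leb]_(s in `[0, t]) moment_rate a b s.
Proof.
move=> a1 b1 t0.
have := moment_identity om_gt0 tau_gt0 mu_pde init_x init_xi a1 b1 t0.
rewrite -/(moment a b t) -/(moment a b 0) => ->.
have [K hK] := drift_bounded t a1 b1; have [D hD] := diffusion_bounded b.
have md := drift_measurable a1 b1; have mf := diffusion_measurable b.
have di : leb.-integrable `[0, t] (EFin \o
    (fun s => bracket (drift_along om tau mu (grad_sq a b) s) (mu s))).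
  by apply: (bounded_itv_integrable (K := K)) => // s /andP[_ /hK].
have fi : leb.-integrable `[0, t] (EFin \o (fun s =>
    2^-1 * bracket (diffusion_along om tau mu (fun=> b * b * 2) s) (mu s))).
  apply: (bounded_itv_integrable (K := 2^-1 * D)).
    by apply: measurable_funM => //; exact: measurable_cst.
  by move=> s _; rewrite normrM ger0_norm ?invr_ge0// ler_wpM2l ?invr_ge0.
rewrite RintegralD// RintegralZl//.
by apply: (bounded_itv_integrable (K := D)).
Qed.

Let moment_continuous a b : `|a| <= 1 -> `|b| <= 1 -> continuous (moment a b).
Proof.
move=> a1 b1; apply: (@primitive_continuous _ (moment_rate a b)).
- exact: moment_rate_measurable.
- by move=> T; exact: moment_rate_bounded.
- by move=> t; exact: moment_integral.
- by move=> t t0; rewrite /moment (@path_neg _ _ mu t t0).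
Qed.

Let lam_sqr s : lam s ^+ 2 = moment 0 1 s.
Proof.
rewrite /lam (@lambda_of_sqr _ (law s) (x_int s)) /moment.
by congr bracket; apply/funext => z; rewrite mul1r mul0r addr0.
Qed.

Let cross_continuous : continuous (fun s => bracket (fun z => z.1 * z.2) (mu s)).
Proof.
have E s : bracket (fun z => z.1 * z.2) (mu s) =
    2^-1 * (moment 1 1 s - moment 0 1 s - moment 1 0 s).
  have lin a b : `|a| <= 1 -> `|b| <= 1 ->
      (law s).-integrable setT (EFin \o (fun z : R * R => (b * z.1 + a * z.2) ^+ 2)).
    move=> a1 b1.
    have [L hL] := linear_moment om_gt0 tau_gt0 mu_pde init_x init_xi s a1 b1.
    exact: (hL s (lexx _)).1.
  have n0 : `|0 : R| <= 1 by rewrite normr0.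
  have n1 : `|1 : R| <= 1 by rewrite normr1.
  have sub_int f g : (law s).-integrable setT (EFin \o f) ->
      (law s).-integrable setT (EFin \o g) ->
      (law s).-integrable setT (EFin \o (fun z : R * R => f z - g z)).
    move=> fi gi; have := integrableB measurableT fi gi.
    by apply: eq_integrable => // z _; rewrite EFinB.
  have i1 := lin 1 1 n1 n1; have i2 := lin 0 1 n0 n1; have i3 := lin 1 0 n1 n0.
  have i12 := sub_int _ _ i1 i2; have i123 := sub_int _ _ i12 i3.
  rewrite /moment /bracket -(@RintegralB _ _ _ (law s) _ _ _ measurableT i1 i2).
  rewrite -(@RintegralB _ _ _ (law s) _ _ _ measurableT i12 i3).
  rewrite -(@RintegralZl _ _ _ (law s) _ _ _ measurableT i123).
  by apply: eq_Rintegral => z _; rewrite !mul1r !mul0r addr0 add0r; field.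
move=> s; rewrite (funext E); apply: cvgM; first exact: cvg_cst.
have n0 : `|0 : R| <= 1 by rewrite normr0.
have n1 : `|1 : R| <= 1 by rewrite normr1.
by apply: cvgB; [apply: cvgB|]; exact: moment_continuous.
Qed.

Lemma bracket_tsq_le_lambda e s : 0 < e ->
  bracket (fun z => tsq e (1 * z.1 + 0 * z.2)) (mu s) <= lam s ^+ 2.
Proof.
move=> e0; rewrite (@lambda_of_sqr _ (law s) (x_int s)).
apply: (@le_Rintegral _ _ _ (law s)) => //.
- exact: tsq_integrable.
- exact: x_int.
by move=> z _; rewrite mul1r mul0r addr0 tsq_le_sqr// ltW.
Qed.

Let lam_ge0 s : 0 <= lam s.
Proof. exact: sqrtr_ge0. Qed.

Let lam_continuous : continuous lam.
Proof.
have n0 : `|0 : R| <= 1 by rewrite normr0.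
have n1 : `|1 : R| <= 1 by rewrite normr1.
move=> s; rewrite (_ : lam = fun s => Num.sqrt (moment 0 1 s)); last first.
  by apply/funext => u; rewrite -lam_sqr sqrtr_sqr ger0_norm.
exact: (cvg_comp _ _ (moment_continuous n0 n1 (x := s)) (sqrt_continuous (x := _))).
Qed.

(** The derivative of lambda^2, that is 2 lambda times the expected derivative of lambda, expanded
    so as to make sense when lambda = 0. *)
Let rate s : R := 2 * tau * (om * Q s ^+ 2 * lam s + lam s - lam s ^+ 2) +
  tau ^+ 2 * (om * Q s ^+ 2 + 1).

Let rateE s : moment_rate 0 1 s = rate s.
Proof.
have n0 : `|0 : R| <= 1 by rewrite normr0.
have n1 : `|1 : R| <= 1 by rewrite normr1.
have [L hL] := grad_sq_moment om_gt0 tau_gt0 mu_pde init_x init_xi s n0 n1.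
have [pi xpi xipi] := pair_integrable om_gt0 tau_gt0 mu_pde init_x init_xi
  (grad_sq_measurable 0 1) (hL s (lexx _)).
have xyi := cross_integrable om_gt0 tau_gt0 mu_pde init_x init_xi s.
rewrite /moment_rate /rate [X in X + _]bracket_drift//.
have -> : bracket (fun z => z.1 * grad_sq 0 1 z) (mu s) = 2 * lam s ^+ 2.
  rewrite /lam (@lambda_of_sqr _ (law s) (x_int s)) /bracket.
  rewrite -(@RintegralZl _ _ _ (law s) _ _ _ measurableT (x_int s)).
  by apply: eq_Rintegral => z _; rewrite /grad_sq; ring.
have -> : bracket (fun z => z.2 * grad_sq 0 1 z) (mu s) =
    2 * bracket (fun z => z.1 * z.2) (mu s).
  rewrite /bracket -(@RintegralZl _ _ _ (law s) _ _ _ measurableT xyi).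
  by apply: eq_Rintegral => z _; rewrite /grad_sq; ring.
have -> : bracket (diffusion_along om tau mu (fun=> 1 * 1 * 2) s) (mu s) =
    tau ^+ 2 * (om * Q s ^+ 2 + 1) * 2.
  rewrite /bracket /diffusion_along /diffusion !mul1r Rintegral_cst//.
  rewrite [X in _ * X](_ : _ = 1) ?mulr1//.
  exact: (congr1 fine (probability_setT (law s))).
(* The factor Q settles the case lambda = 0: Q is then 0 by division by zero, and both sides
   vanish. *)
have Qxy : Q s * bracket (fun z => z.1 * z.2) (mu s) = Q s ^+ 2 * lam s.
  have [l0|l0] := eqVneq (lam s) 0.
    by rewrite /Q /cosine_of -/(lam s) l0 invr0 !mulr0 mul0r.
  by rewrite expr2 -mulrA; congr (_ * _); rewrite /Q /cosine_of -/(lam s) mulfVK.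
have lamV : (lam s)^-1 * lam s ^+ 2 = lam s.
  have [->|l0] := eqVneq (lam s) 0; first by rewrite expr0n /= mulr0.
  by rewrite expr2 mulKf.
rewrite -/(lam s) -/(Q s).
have -> : om * Q s * (2 * bracket (fun z => z.1 * z.2) (mu s)) =
    2 * om * (Q s ^+ 2 * lam s) by rewrite -Qxy; ring.
have -> : (lam s)^-1 * (2 * lam s ^+ 2) = 2 * lam s by rewrite -[in RHS]lamV; ring.
by field.
Qed.

Let lam_integral t : 0 <= t ->
  lam t ^+ 2 - lam 0 ^+ 2 = \int[leb]_(s in `[0, t]) rate s.
Proof.
move=> t0; have n0 : `|0 : R| <= 1 by rewrite normr0.
have n1 : `|1 : R| <= 1 by rewrite normr1.
rewrite !lam_sqr moment_integral//.
by apply: eq_Rintegral => s _; exact: rateE.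
Qed.

Let rate_measurable : measurable_fun setT rate.
Proof.
rewrite -(funext rateE); apply: moment_rate_measurable.
  by rewrite normr0.
by rewrite normr1.
Qed.

(* Near a zero of lambda the noise makes the derivative of lambda^2 at least
   tau^2 / 2, so lambda^2 would be negative just before that zero. *)
Lemma lambda_gt0 t : 0 < t -> 0 < lam t.
Proof.
move=> t0; rewrite lt_neqAle lam_ge0 andbT; apply/eqP => /esym lt0.
have c2 : lam u ^+ 2 @[u --> t] --> (0 : R).
  rewrite -[X in _ --> X](mulr0 0) -lt0.
  by apply: cvgM; exact: lam_continuous.
(* Where lambda^2 < tau / 4, the only negative term, - 2 tau lambda^2, exceeds - tau^2 / 2, while
   the noise contributes at least tau^2. *)
have [e /= e0 he] : nbhs_ball t [set u | lam u ^+ 2 < tau / 4].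
  by apply/nbhs_ballP; apply: (cvgr_lt _ c2); rewrite divr_gt0.
(* The minimum keeps [u, t] inside the ball and u nonnegative. *)
pose u := t - Num.min e t / 2.
have m0 : 0 < Num.min e t by rewrite lt_min e0 t0.
have me : Num.min e t <= e by rewrite ge_min lexx.
have mt : Num.min e t <= t by rewrite ge_min lexx orbT.
have u0 : 0 <= u by rewrite /u; lra.
have ut : u < t by rewrite /u; lra.
have rate_ge s : u <= s <= t -> tau ^+ 2 / 2 <= rate s.
  move=> /andP[us st]; have /= hs : lam s ^+ 2 < tau / 4.
    by apply: he; rewrite /ball /= ger0_norm ?subr_ge0//; move: us; rewrite /u; lra.
  have Q2 : 0 <= om * Q s ^+ 2 by rewrite mulr_ge0 ?sqr_ge0// ltW.
  have Q2l : 0 <= om * Q s ^+ 2 * lam s by rewrite mulr_ge0.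
  have l0 := lam_ge0 s.
  rewrite /rate; move: (om * Q s ^+ 2) (lam s ^+ 2) Q2 Q2l hs => k l Q2 Q2l hs.
  have h1 : 0 <= tau * (k * lam s + lam s) by rewrite mulr_ge0 ?(ltW tau_gt0)// addr_ge0.
  have h2 : 0 <= tau ^+ 2 * k by rewrite mulr_ge0// sqr_ge0.
  have h3 : tau * l <= tau * (tau / 4) by rewrite ler_wpM2l ?(ltW tau_gt0)// ltW.
  by lra.
have n0 : `|0 : R| <= 1 by rewrite normr0.
have n1 : `|1 : R| <= 1 by rewrite normr1.
have [K hK] := moment_rate_bounded t n0 n1.
have rK s : 0 <= s <= t -> `|rate s| <= K by move=> /hK; rewrite rateE.
have ut' := ltW ut.
have : tau ^+ 2 / 2 * (t - u) <= \int[leb]_(s in `[u, t]) rate s.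
  rewrite -Rintegral_itv_cst//; apply: le_Rintegral => //.
  - apply: (@bounded_itv_integrable _ (fun=> tau ^+ 2 / 2) u t `|tau ^+ 2 / 2|) => //.
  - apply: (bounded_itv_integrable (K := K)) => // s /andP[us st].
    by apply: rK; rewrite (le_trans u0).
rewrite -(Rintegral_itv_split rate_measurable u0 ut' rK).
rewrite -!lam_integral//; last exact: ltW.
rewrite lt0 expr0n /=.
have h1 : 0 < tau ^+ 2 / 2 * (t - u) by rewrite mulr_gt0 ?divr_gt0 ?exprn_gt0// subr_gt0.
have h2 := sqr_ge0 (lam u); lra.
Qed.

Hypothesis init_pos : 0 < lam 0.

(** The argument of [lambda_gt0] looks just before a zero and so says nothing at t = 0, where
    positivity must come from the initial law. *)
Let lam_pos t : 0 <= t -> 0 < lam t.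
Proof. by rewrite le_eqVlt => /predU1P[<-//|]; exact: lambda_gt0. Qed.

Let rate_continuous : continuous rate.
Proof.
have lp s : 0 < lam s.
  have [|s0] := leP 0 s; first exact: lam_pos.
  by rewrite /lam (@path_neg _ _ mu s s0).
have cQ : continuous Q.
  move=> s; apply: cvgM; first exact: cross_continuous.
  by apply: cvgV; [rewrite gt_eqF// lp|exact: lam_continuous].
have cQ2 : continuous (fun s => Q s ^+ 2) by move=> s; apply: cvgM; exact: cQ.
have cl2 : continuous (fun s => lam s ^+ 2).
  by move=> s; apply: cvgM; exact: lam_continuous.
have cl := lam_continuous.
have cc (k : R) : continuous (fun _ : R => k) by move=> s; exact: cvg_cst.
move=> s; apply: cvgD.
  apply: cvgM; first exact: cc.
  apply: cvgB; last exact: cl2.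
  apply: cvgD; last exact: cl.
  by apply: cvgM; [apply: cvgM; [exact: cc|exact: cQ2]|exact: cl].
apply: cvgM; first exact: cc.
by apply: cvgD; [apply: cvgM; [exact: cc|exact: cQ2]|exact: cc].
Qed.

(** The extension G is differentiable at 0 too, so it yields both the derivative of lambda at
    positive times and its right derivative at 0. *)
Lemma lambda_ode : exists2 G : R -> R, (forall t, 0 <= t -> G t = lam t) &
  forall t, 0 <= t -> is_derive t 1 G (tau * (om * Q t ^+ 2 + 1 - lam t +
    tau * (om * Q t ^+ 2 + 1) / (2 * lam t))).
Proof.
have [F FE dF] := primitive_derive rate_continuous lam_integral.
exists (fun t => Num.sqrt (F t)) => t t0.
  by rewrite FE// sqrtr_sqr ger0_norm.
have lt0 := lam_pos t0.
have Ft : 0 < F t by rewrite FE// exprn_gt0.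
have dS := is_derive1_sqrt Ft.
have := @is_derive1_comp _ Num.sqrt F t _ _ dS (dF t t0).
move=> h; apply: (trigger_derive h); rewrite FE// sqrtr_sqr ger0_norm ?ltW//.
by rewrite /rate; field; rewrite gt_eqF.
Qed.

End lambda_ode.

(** Paths are extended to negative times by their value at 0, so at t = 0 the derivative of lambda
    is expressed as a right limit. *)
Theorem corollary2 (R : realType) (om tau : R) (om_gt0 : 0 < om) (tau_gt0 : 0 < tau)
    (d : nat -> measure_display) (Om : forall p, measurableType (d p))
    (P : forall p, probability (Om p) R)
    (* the dimension is p.+1 *)
    (xi : forall p, 'cV[R]_p.+1)
    (x0 : forall p, Om p -> 'cV[R]_p.+1)
    (c : forall p, nat -> Om p -> R)
    (a : forall p, nat -> Om p -> 'cV[R]_p.+1)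
    (xi_norm : forall p, norm2 (xi p) = Num.sqrt p.+1%:R)
    (noise : forall p, spiked_noise (P p) (x0 p) (c p) (a p))
    (mu : skorokhod R (measR2 R))
    (x0_exch : forall p, exchangeable (P p) (x0 p))
    (x0_moment : exists C : R, forall p, {ae P p, forall w,
       bracket (fun z => z.1 ^+ 4 + z.2 ^+ 4) (emp (x0 p w) (xi p)) <= C})
    (x0_cvg : weak_cvg_to_point P (fun p w => emp (x0 p w) (xi p)) (mu 0))
    (lambda0 : exists b B : R, 0 < b /\ forall p, {ae P p, forall w,
       b <= vec_lambda (x0 p w) <= B})
    (Q0 : forall p, {ae P p, forall w, vec_cosine (xi p) (x0 p w) != 0})
    (mu_lim : weak_cvg_to_point P (fun p w =>
       emp_process
         (ino_iterate tau (fun k => sample om (xi p) (c p k w) (a p k w)) (x0 p w))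
         (xi p)) mu)
    (mu_pde : weak_solution tau om mu) :
  let lam := fun t : R => lambda_of (mu t) in
  let Q := fun t : R => cosine_of (mu t) in
  let rhs := fun t : R =>
    tau * (om * Q t ^+ 2 + 1 - lam t + tau * (om * Q t ^+ 2 + 1) / (2 * lam t)) in
  (forall t : R, 0 < t -> is_derive t 1 lam (rhs t)) /\
  (h^-1 * (lam h - lam 0) @[h --> 0^'+] --> rhs 0).
Proof.
move=> lam Q rhs.
have [C hC] := x0_moment; have [b [B [b0 hbB]]] := lambda0.
have x0_random p : random_element (@x0 p) by have [] := noise p.
have init_x e : 0 < e -> bracket (fun z => tsq e (1 * z.1 + 0 * z.2)) (mu 0) <= 1 + C.
  by move=> e0; apply: (initial_moment_le x0_random x0_cvg) => //; left.
have init_xi e : 0 < e -> bracket (fun z => tsq e (0 * z.1 + 1 * z.2)) (mu 0) <= 1 + C.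
  by move=> e0; apply: (initial_moment_le x0_random x0_cvg) => //; right.
have lam0 : 0 < lam 0.
  (* This e makes the loss e C at most b^2 / 2, leaving lambda_0^2 >= b^2 / 2. The sign of C is
     unknown, hence |C| + 1. *)
  pose e := b ^+ 2 / (2 * (`|C| + 1)).
  have C1 : 0 < `|C| + 1 by rewrite ltr_wpDl.
  have e0 : 0 < e by rewrite divr_gt0 ?exprn_gt0// mulr_gt0.
  have hb p : {ae P p, forall w, b <= vec_lambda (@x0 p w)}.
    by apply: filterS (hbB p) => w /andP[].
  have := le_trans (initial_moment_ge x0_random x0_cvg e0 b0 hC hb)
    (bracket_tsq_le_lambda om_gt0 tau_gt0 mu_pde init_x init_xi 0 e0).
  rewrite -/(lam 0) => h.
  have eC : e * C <= b ^+ 2 / 2.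
    apply: (@le_trans _ _ (e * (`|C| + 1))).
      by rewrite ler_wpM2l ?(ltW e0)// ler_wpDr// ler_norm.
    by rewrite le_eqVlt; apply/orP; left; apply/eqP; rewrite /e; field; rewrite gt_eqF.
  have b2 : 0 < b ^+ 2 by rewrite exprn_gt0.
  have : 0 < lam 0 ^+ 2 by lra.
  by rewrite lt_neqAle sqr_ge0 andbT eq_sym sqrf_eq0 lt_neqAle sqrtr_ge0 andbT eq_sym.
have [G GE dG] := lambda_ode om_gt0 tau_gt0 mu_pde init_x init_xi lam0.
split=> [t t0|].
  (* Around t > 0 all times are positive, so lambda and G coincide on a neighbourhood. *)
  apply: near_eq_is_derive (dG t (ltW t0)); near=> u; apply: GE; apply: ltW.
  by near: u; exact: lt_nbhsr.
have [dG0 G0] := dG 0 (lexx _).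
have : h^-1 *: (G (h *: 1 + 0) - G 0) @[h --> 0^'+] --> rhs 0.
  by apply: cvg_dnbhs_at_right; rewrite /rhs -G0; exact: dG0.
apply: cvg_trans; apply: near_eq_cvg; near=> h.
rewrite scaler1 addr0 !GE//.
Unshelve. all: by end_near. Qed.
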